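(* Given a graph $G=(V,E)$ with maximum degree $\Delta$ and any $\epsilon>0$, one can construct in (deterministic) polynomial time a triangle-free graph $\widehat G=(\widehat V,\widehat E)$ with \[\mathrm{rel\text{-}IS}(G)\le\mathrm{rel\text{-}IS}(\widehat G)\le(1+\epsilon)\,\mathrm{rel\text{-}IS}(G).\] Moreover $\widehat G$ has (a) $\mathrm{poly}(\Delta,\epsilon^{-1})\,|V|$ vertices, and (b) maximum degree $O(\Delta^3\epsilon^{-2})$.
   Context: For a graph $G=(V,E)$, $\mathrm{IS}(G)$ is the size of a maximum independent set and $\mathrm{rel\text{-}IS}(G)=\mathrm{IS}(G)/|V|$. A graph is triangle-free if it contains no cycle of length 3. *)

(* Defs.v *)
From mathcomp Require Import all_boot all_order all_algebra.
From mathcomp Require Import reals.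

Set Implicit Arguments.
Unset Strict Implicit.
Unset Printing Implicit Defensive.

Import Order.TTheory GRing.Theory Num.Theory.

Section Graphs.
Variable V : finType.
Implicit Types (e : rel V) (S : {set V}).

Definition simple_graph e : Prop := symmetric e /\ irreflexive e.

Definition max_degree e : nat := \max_(x : V) #|[set y | e x y]|.

Definition independent e S : bool :=
  [forall x in S, forall y in S, ~~ e x y].

Definition IS e : nat := \max_(S : {set V} | independent e S) #|S|.

Definition rel_IS (R : realType) e : R := ((IS e)%:R / #|V|%:R)%R.

Definition triangle_free e : Prop :=
  forall c : seq V, ucycle e c -> size c != 3.
End Graphs.

(* The model of computation is a random access machine with structured        *)
(* control flow: registers holding natural numbers, an unbounded memory, and  *)
(* an append-only output tape. The only arithmetic operations are addition    *)
(* and truncated subtraction, each of unit cost (there is no multiplication   *)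
(* or shift), so a number computed within t steps has O(t) more bits than     *)
(* those of the input, and time on this machine is polynomially related to    *)
(* time on a deterministic Turing machine (Cook and Reckhow, 1973).           *)

Inductive expr : Type :=
  | Const of nat
  | Reg of nat
  | Fetch of expr
  | Add of expr & expr
  | Sub of expr & expr.

Inductive cmd : Type :=
  | Assign of nat & expr
  | Store of expr & expr
  | Output of expr
  | Seq of cmd & cmd
  | If of expr & cmd & cmd
  | While of expr & cmd.

Record state : Type := State {
  regs : nat -> nat;
  mem : nat -> nat;
  out : seq nat }.

Definition update (f : nat -> nat) (i v : nat) : nat -> nat :=
  fun j => if j == i then v else f j.

Fixpoint eval (s : state) (x : expr) : nat :=
  match x with
  | Const k => k
  | Reg i => regs s i
  | Fetch y => mem s (eval s y)
  | Add y z => eval s y + eval s z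
  | Sub y z => eval s y - eval s z
  end.

(* The time needed to evaluate an expression: one unit per node. *)
Fixpoint cost (x : expr) : nat :=
  match x with
  | Const _ | Reg _ => 1
  | Fetch y => (cost y).+1
  | Add y z | Sub y z => (cost y + cost z).+1
  end.

(* exec c s t s' : started in s, the command c halts in s' after t steps.     *)
(* In If and While, a nonzero value counts as true.                           *)
Inductive exec : cmd -> state -> nat -> state -> Prop :=
  | ExecAssign i x s :
      exec (Assign i x) s (cost x).+1
           (State (update (regs s) i (eval s x)) (mem s) (out s))
  | ExecStore x y s :
      exec (Store x y) s (cost x + cost y).+1
           (State (regs s) (update (mem s) (eval s x) (eval s y)) (out s))
  | ExecOutput x s :
      exec (Output x) s (cost x).+1
           (State (regs s) (mem s) (rcons (out s) (eval s x)))
  | ExecSeq c1 c2 s t1 s1 t2 s2 :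
      exec c1 s t1 s1 -> exec c2 s1 t2 s2 ->
      exec (Seq c1 c2) s (t1 + t2) s2
  | ExecIfTrue x c1 c2 s t s' :
      eval s x != 0 -> exec c1 s t s' ->
      exec (If x c1 c2) s (cost x + t).+1 s'
  | ExecIfFalse x c1 c2 s t s' :
      eval s x = 0 -> exec c2 s t s' ->
      exec (If x c1 c2) s (cost x + t).+1 s'
  | ExecWhileTrue x c s t1 s1 t2 s2 :
      eval s x != 0 -> exec c s t1 s1 -> exec (While x c) s1 t2 s2 ->
      exec (While x c) s (cost x + t1 + t2).+1 s2
  | ExecWhileFalse x c s :
      eval s x = 0 ->
      exec (While x c) s (cost x).+1 s.

Lemma exec_deterministic c s t1 s1 t2 s2 :
  exec c s t1 s1 -> exec c s t2 s2 -> t1 = t2 /\ s1 = s2.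
Proof.
move=> H; elim: H t2 s2 => {c s t1 s1}.
- by move=> i x s t2 s2 H; inversion H.
- by move=> x y s t2 s2 H; inversion H.
- by move=> x s t2 s2 H; inversion H.
- move=> c1 c2 s t1 s1 t2 s2 _ IH1 _ IH2 t s' H; inversion H; subst.
  case: (IH1 _ _ ltac:(eassumption)) => ? ?; subst.
  by case: (IH2 _ _ ltac:(eassumption)) => ? ?; subst.
- move=> x c1 c2 s t s' nz _ IH t' s'' H; inversion H; subst.
    by case: (IH _ _ ltac:(eassumption)) => ? ?; subst.
  by move/eqP: nz.
- move=> x c1 c2 s t s' z _ IH t' s'' H; inversion H; subst.
    match goal with H : is_true (_ != _) |- _ => by rewrite z in H end.
  by case: (IH _ _ ltac:(eassumption)) => ? ?; subst.
- move=> x c s t1 s1 t2 s2 nz _ IH1 _ IH2 t s' H; inversion H; subst.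
    case: (IH1 _ _ ltac:(eassumption)) => ? ?; subst.
    by case: (IH2 _ _ ltac:(eassumption)) => ? ?; subst.
  by move/eqP: nz.
- move=> x c s z t s' H; inversion H; subst=> //.
  match goal with H : is_true (_ != _) |- _ => by rewrite z in H end.
Qed.

(* The input is stored in the memory from address 0 on. *)
Definition initial_state (input : seq nat) : state :=
  State (fun=> 0) (nth 0 input) [::].

Definition computes_in_time (c : cmd) (input : seq nat) (t : nat)
    (output : seq nat) : Prop :=
  exists2 s : state, exec c (initial_state input) t s & out s = output.

(* The number of vertices, then the adjacency matrix in row-major order. *)
Definition graph_code (n : nat) (e : rel 'I_n) : seq nat :=
  n :: [seq nat_of_bool (e i j) | i <- enum 'I_n, j <- enum 'I_n].

(* An algorithm can only be handed a finite description of a real eps > 0:    *)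
(* here a rational number a / b that approximates eps from below within a     *)
(* factor 2 (for rational eps, a / b = eps is allowed).                       *)
Definition rational_approx (R : realType) (a b : nat) (eps : R) : Prop :=
  (0 < b)%N /\ (eps / 2%:R <= a%:R / b%:R <= eps)%R.

(* Main.v *)
Require Import Defs.
From mathcomp Require Import all_boot all_order all_algebra.
From mathcomp Require Import reals zify ring lra.

(* Let D be the maximum degree and q an odd prime. The blow-up has vertex set *)
(* V x F_q^2, and an edge uv of G with u < v joins (u, x) to (v, y) when      *)
(* y - x = (t, t^2) for some t != 0. A triangle would give two nonzero points *)
(* of the parabola whose sum is on the parabola, which is impossible. A       *)
(* nonzero vector is a difference of two points of the parabola in at most    *)
(* one way, so a second moment computation shows that two subsets of F_q^2 of *)
(* density greater than 1/m are joined as soon as q >= 3 m^2. Hence the       *)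
(* vertices u whose fibre in an independent set has density greater than 1/m  *)
(* form an independent set of G, and the relative independence number grows   *)
(* by at most 1/m, which is at most eps rel_IS(G) for m >= (D + 1) / eps.     *)
(* Chebyshev's estimate provides a prime q = O(m^2) = O(D^2 / eps^2), found   *)
(* by trial division. If eps >= D, a single vertex is output instead.         *)

Set Implicit Arguments.
Unset Strict Implicit.
Unset Printing Implicit Defensive.

Import Order.TTheory GRing.Theory Num.Theory.

(** * A prime between x and a constant multiple of x *)

(** Each vertex of G becomes a copy of F_q^2 and each edge a bipartite pattern that is pseudorandom,
    yet directed so that three copies never close up to a triangle ([parabola_sumfree],
    [oriented_prod_triangle_free]). The preimage of an independent set of G is independent, which
    gives the lower bound ([oriented_prod_IS_ge]). Conversely, the mixing bound [parabola_mixing], a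
    consequence of [parabola_codegree], makes the heavy fibres of an independent set independent in
    G, while the light fibres hold at most a fraction 1/m of all vertices ([oriented_prod_IS_le]).
    This additive loss becomes a relative one because rel_IS(G) >= 1/(D+1), by [card_le_IS_degree].
    The size of the blow-up and its degree depend only on q, which [exists_prime_ge] keeps within a
    constant factor of 3 m^2.

    For the algorithm, [run] is a timed program logic for the machine; [run_main] derives the output
    and the running time of [main_cmd], and [blowup_code] recognises this output as the code of the
    blow-up. *)

Lemma prod_primes_dvdn (m : nat) (s : seq nat) :
  uniq s -> all prime s -> all (fun p => p %| m) s -> \prod_(p <- s) p %| m.
Proof.
elim: s => [|p s IHs] /=; first by rewrite big_nil dvd1n.
move=> /andP[p_s us] /andP[pr_p pr_s] /andP[pm sm].
rewrite big_cons Gauss_dvd ?pm ?IHs //.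
rewrite big_seq; apply: (big_ind (coprime p)) => [|x y px py|r rs].
- by rewrite coprimen1.
- by rewrite coprimeMr px.
have pr_r := allP pr_s _ rs.
rewrite prime_coprime // dvdn_prime2 //.
by apply: contraNneq p_s => ->.
Qed.

Lemma bin_double_le (n : nat) : 'C(n.*2, n) <= 4 ^ n.
Proof.
rewrite -[4]/(2 ^ 2) -expnM mul2n -[2]/(1 + 1) expnDn.
have lt_n : n < n.*2.+1 by lia.
by rewrite (bigD1 (Ordinal lt_n)) //= !exp1n !muln1 leq_addr.
Qed.

Lemma bin_double_ge (n : nat) : 2 ^ n <= 'C(n.*2, n).
Proof.
elim: n => // n IHn; rewrite doubleS binS expnS.
have -> : 'C(n.*2.+1, n.+1) = 'C(n.*2.+1, n).
  by rewrite -bin_sub ?subSS; [congr 'C(_, _); lia | lia].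
have := leq_bin2l n (leqnSn n.*2); lia.
Qed.

Definition primorial (n : nat) := \prod_(p <- iota 0 n.+1 | prime p) p.

Lemma prime_dvdn_fact (p n : nat) : prime p -> p %| n`! -> p <= n.
Proof.
move=> pr_p; elim: n => [|n IHn]; first by rewrite dvdn1 => /eqP p1; rewrite p1 in pr_p.
by rewrite factS Euclid_dvdM // => /orP[/dvdn_leq->// | /IHn/leqW].
Qed.

Lemma bin_double_fact (n : nat) : 'C(n.*2, n) * (n`! * n`!) = (n.*2)`!.
Proof. by have := bin_fact (leq_addr n n); rewrite addKn addnn. Qed.

Lemma prime_dvdn_bin_double (n p : nat) :
  prime p -> n < p <= n.*2 -> p %| 'C(n.*2, n).
Proof.
move=> pr_p /andP[lt_np le_p].
have : p %| (n.*2)`! by rewrite dvdn_fact ?prime_gt0.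
have pF : ~~ (p %| n`!) by apply/negP => /(prime_dvdn_fact pr_p); lia.
by rewrite -bin_double_fact !Euclid_dvdM // (negPf pF) !orbF.
Qed.

(** The primes in (n, 2n] all divide the central binomial coefficient, so their product is at most
    4^n. *)
Lemma primorial_double (n : nat) : primorial n.*2 <= primorial n * 4 ^ n.
Proof.
rewrite /primorial (_ : n.*2.+1 = n.+1 + n); last by lia.
rewrite iotaD big_cat leq_mul2l; apply/orP; right.
apply: leq_trans (bin_double_le n).
apply: dvdn_leq; first by rewrite bin_gt0 -addnn leq_addr.
rewrite -big_filter; apply: prod_primes_dvdn.
- by rewrite filter_uniq ?iota_uniq.
- by apply/allP => p; rewrite mem_filter => /andP[].
apply/allP => p; rewrite mem_filter mem_iota => /andP[pr_p p_lt].
by apply: prime_dvdn_bin_double => //; lia.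
Qed.

Lemma primorial_pow2 (k : nat) : primorial (2 ^ k) <= 4 ^ 2 ^ k.
Proof.
elim: k => [|k IHk]; first by rewrite /primorial unlock.
rewrite expnS mul2n (leq_trans (primorial_double _)) //.
by rewrite -[in X in _ <= X]addnn expnD leq_mul2r IHk orbT.
Qed.

(** By Legendre's formula the exponent is the sum over k of floor(2n / p^k) - 2 floor(n / p^k). Each
    term is 0 or 1, and it vanishes once p^k > 2n. *)
Lemma logn_bin_double (p n : nat) :
  prime p -> 0 < n -> p ^ logn p 'C(n.*2, n) <= n.*2.
Proof.
move=> pr_p n_gt0; have p_gt1 := prime_gt1 pr_p.
have n2_gt0 : 0 < n.*2 by lia.
apply: leq_trans (trunc_logP p_gt1 n2_gt0); rewrite leq_exp2l //.
set l := trunc_log p n.*2.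
(* Legendre's sum is padded with zero terms, so that n! and (2n)! share one range of summation. *)
have EF (m : nat) : m <= n.*2 -> logn p m`! = \sum_(1 <= k < n.*2.+1) m %/ p ^ k.
  move=> le_m; rewrite logn_fact // [RHS](big_cat_nat (n := m.+1)) //=.
  rewrite [X in _ = _ + X]big_nat [X in _ = _ + X]big1 ?addn0 // => k /andP[lt_mk _].
  by rewrite divn_small // (ltn_trans lt_mk) // ltn_expl.
have /eqP : logn p 'C(n.*2, n) + (logn p n`! + logn p n`!) = logn p (n.*2)`!.
  by rewrite -bin_double_fact !lognM ?muln_gt0 ?fact_gt0 ?bin_gt0 //; lia.
rewrite !EF //; last by lia.
rewrite -!big_split /= => /eqP E.
suff : \sum_(1 <= k < n.*2.+1) n.*2 %/ p ^ k <=
       l + \sum_(1 <= k < n.*2.+1) (n %/ p ^ k + n %/ p ^ k).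
  by rewrite -E leq_add2r.
have le_l : l <= n.*2.
  by rewrite (leq_trans _ (trunc_logP p_gt1 n2_gt0)) // ltnW // ltn_expl.
have -> : l = \sum_(1 <= k < n.*2.+1) (k <= l).
  rewrite [RHS](big_cat_nat (n := l.+1)) //=.
  rewrite [X in _ = X + _](_ : _ = \sum_(1 <= k < l.+1) 1).
    rewrite sum_nat_const_nat subn1 muln1 /=.
    rewrite [X in _ = _ + X]big_nat [X in _ = _ + X]big1 ?addn0 // => k.
    by case/andP=> lt_lk _; rewrite leqNgt lt_lk.
  by apply: eq_big_nat => k /andP[_]; rewrite ltnS => ->.
rewrite -big_split; apply: leq_sum => k _ /=.
have pk : 0 < p ^ k by rewrite expn_gt0 prime_gt0.
case: (leqP k l) => [_|lt_lk].
  have := divn_eq n (p ^ k); have := ltn_pmod n pk.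
  have := divn_eq n.*2 (p ^ k); have := ltn_pmod n.*2 pk.
  nia.
rewrite [n.*2 %/ _]divn_small ?leq0n // ltnNge.
by apply: contraL lt_lk => /(trunc_log_max p_gt1); rewrite -leqNgt.
Qed.

(** The at most s primes up to s contribute at most 2n each. A prime p > s has p^2 > 2n, so it
    divides at most once, and by hypothesis it is at most x. *)
Lemma bin_double_le_primorial (n s x : nat) :
    0 < n -> n.*2 <= s ^ 2 ->
    (forall p, prime p -> x < p -> n.*2 < p) ->
  'C(n.*2, n) <= n.*2 ^ s * primorial x.
Proof.
move=> n_gt0 le_s no_p.
have C_gt0 : 0 < 'C(n.*2, n) by rewrite bin_gt0; lia.
have ub p : p \in primes 'C(n.*2, n) -> prime p && (p <= x).
  rewrite mem_primes => /and3P[pr_p _ pC]; rewrite pr_p /= leqNgt; apply/negP.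
  move/(no_p p pr_p); apply/negP; rewrite -leqNgt (prime_dvdn_fact pr_p) //.
  by rewrite -bin_double_fact dvdn_mulr.
rewrite {1}(prod_prime_decomp C_gt0) prime_decompE big_map /=.
rewrite (bigID (fun p => p <= s)) /= leq_mul //.
  apply: (@leq_trans (\prod_(p <- primes 'C(n.*2, n) | p <= s) n.*2)).
    rewrite big_seq_cond [X in _ <= X]big_seq_cond.
    by apply: leq_prod => p /andP[/ub/andP[pr_p _] _]; apply: logn_bin_double.
  rewrite -big_filter big_const_seq count_predT iter_muln_1 leq_pexp2l //; first by lia.
  rewrite -[X in _ <= X](size_iota 1); apply: uniq_leq_size.
    by rewrite filter_uniq ?primes_uniq.
  move=> p; rewrite mem_filter mem_iota => /andP[le_p /ub/andP[/prime_gt0]]; lia.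
apply: (@leq_trans (\prod_(p <- primes 'C(n.*2, n)) p)).
  rewrite [X in _ <= X](bigID (fun p => p <= s)) /= -[X in X <= _]mul1n leq_mul //.
    by rewrite big_seq_cond prodn_cond_gt0 // => p /andP[/ub/andP[/prime_gt0]].
  rewrite big_seq_cond [X in _ <= X]big_seq_cond.
  apply: leq_prod => p /andP[/ub/andP[pr_p _]]; rewrite -ltnNge => lt_sp.
  rewrite -[X in _ <= X]expn1 leq_exp2l ?prime_gt1 // -ltnS.
  rewrite -(ltn_exp2l _ _ (prime_gt1 pr_p)) (leq_ltn_trans (logn_bin_double pr_p n_gt0)) //.
  by rewrite (leq_ltn_trans le_s) // ltn_exp2r.
rewrite /primorial -[X in _ <= X]big_filter.
apply: dvdn_leq.
  by rewrite big_filter prodn_cond_gt0 // => p /prime_gt0.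
apply: prod_primes_dvdn; rewrite ?primes_uniq //; apply/allP => p /ub/andP[pr_p le_p] //.
have p_in : p \in [seq r <- iota 0 x.+1 | prime r] by rewrite mem_filter pr_p mem_iota ltnS.
by rewrite (big_rem p p_in) dvdn_mulr.
Qed.

(** Erdos's argument with x = 2^(2l+9) and n = 4x; the even exponent makes the square root of 2n the
    integer 2^m. Without a prime in (x, 2n], one gets 2^n <= C(2n, n) <= (2n)^(2^m) 4^x, that is, 2x
    <= (2l + 12) 2^m, which fails since x = 2^m 2^(l+3). *)
Lemma prime_between_pow2 (l : nat) :
  exists p, [/\ prime p, 2 ^ (l.*2 + 9) < p & p <= 2 ^ (l.*2 + 12)].
Proof.
set m := l + 6; set x := 2 ^ (l.*2 + 9).
have dm : 2 ^ (l.*2 + 12) = (2 ^ (m.*2.-1)).*2.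
  by rewrite -[(2 ^ _).*2]mul2n -expnS /m; congr (2 ^ _); lia.
rewrite dm; set n := 2 ^ _.
have n_gt0 : 0 < n by rewrite expn_gt0.
pose good p := [&& prime p, x < p & p <= n.*2].
case: (boolP (has good (iota 0 n.*2.+1))) => [/hasP[p _ /and3P[]] | no_p].
  by exists p.
have {}no_p p : prime p -> x < p -> n.*2 < p.
  move=> pr_p lt_p; rewrite ltnNge; apply/negP => le_p; case/hasP: no_p.
  by exists p; [rewrite mem_iota | apply/and3P].
have le_s : n.*2 <= (2 ^ m) ^ 2 by rewrite -dm -expnM leq_exp2l // /m; lia.
have := leq_trans (bin_double_ge n) (bin_double_le_primorial n_gt0 le_s no_p).
have /(leq_mul (leqnn (n.*2 ^ 2 ^ m))) := primorial_pow2 (l.*2 + 9).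
move=> le1 /leq_trans/(_ le1).
rewrite -dm -expnM -[4]/(2 ^ 2) -expnM -expnD leq_exp2l // -/x.
have ->: n = 2 ^ 2 * x by rewrite /x -expnD /n /m; congr (2 ^ _); lia.
have -> : x = 2 ^ m * 2 ^ (l + 3) by rewrite /x -expnD /m; congr (2 ^ _); lia.
have : l.*2 + 12 < 2 * 2 ^ (l + 3).
  by elim: (l) => // k; rewrite addSn !expnS; lia.
have : 0 < 2 ^ m by rewrite expn_gt0.
by move: (2 ^ m) (2 ^ (l + 3)) => A B; nia.
Qed.

Lemma exists_prime_ge (x : nat) :
  0 < x -> exists p, [/\ prime p, x <= p & p <= 2 ^ 12 * x].
Proof.
move=> x_gt0.
have exl : exists l, x <= 2 ^ (l.*2 + 9).
  exists x; apply: (leq_trans (ltnW (ltn_expl x (ltnSn 1)))).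
  by rewrite leq_exp2l //; lia.
case: (ex_minnP exl) => l le_x min_l.
have [p [pr_p lt_p le_p]] := prime_between_pow2 l.
exists p; split=> //; first exact: leq_trans le_x (ltnW lt_p).
(* For l = 0 only p <= 2^12 is known, whence the constant; for larger l, minimality of l gives a
   better ratio. *)
apply: leq_trans le_p _; case: l min_l {le_x lt_p} => [_|l min_l].
  by rewrite -[X in X <= _]muln1 leq_mul2l x_gt0 orbT.
have : ~~ (x <= 2 ^ (l.*2 + 9)) by apply/negP => /min_l; rewrite ltnn.
rewrite -ltnNge => lt_x.
apply: leq_trans (leq_mul (leqnn _) (ltnW lt_x)).
by rewrite -expnD leq_exp2l //; lia.
Qed.

(** * The parabola over a finite field *)

Section Parabola.
Variable F : finFieldType.
Hypothesis two_neq0 : (2%:R != 0 :> F)%R.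
Implicit Types (x y z : F * F) (A B : {set F * F}).
Local Open Scope ring_scope.

(** The Cayley digraph of the plane generated by the nonzero points of the parabola. *)
Definition parabola : rel (F * F) := fun x y =>
  (y.1 - x.1 != 0) && (y.2 - x.2 == (y.1 - x.1) ^+ 2).

(** The equation s^2 + t^2 = (s + t)^2 forces 2 s t = 0. *)
Lemma parabola_sumfree x y z : parabola x y -> parabola y z -> ~~ parabola x z.
Proof.
move=> /andP[n1 /eqP e1] /andP[n2 /eqP e2]; apply/negP => /andP[_ /eqP e3].
have : 2%:R * (y.1 - x.1) * (z.1 - y.1) == 0.
  rewrite (_ : _ * _ = (z.1 - x.1) ^+ 2 - (y.1 - x.1) ^+ 2 - (z.1 - y.1) ^+ 2); last by ring.
  by rewrite -e1 -e2 -e3; apply/eqP; ring.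
by rewrite !mulf_eq0 (negPf two_neq0) (negPf n1) (negPf n2).
Qed.

Lemma card_parabola_pred y : #|[set x | parabola x y]| = #|F|.-1.
Proof.
rewrite -(cardC1 (0 : F)) -[RHS](card_imset _ (f := fun t => (y.1 - t, y.2 - t ^+ 2))); last first.
  by move=> t s [/addrI/oppr_inj].
apply: eq_card => x; rewrite inE; apply/idP/imsetP => [/andP[nz /eqP e2]|[t nz ->]].
  exists (y.1 - x.1); first by rewrite inE.
  by rewrite -e2 !subKr -surjective_pairing.
by rewrite /parabola /= !subKr eqxx andbT; rewrite !inE in nz.
Qed.

Lemma card_parabola_succ x : #|[set y | parabola x y]| = #|F|.-1.
Proof.
rewrite -(cardC1 (0 : F)) -[RHS](card_imset _ (f := fun t => (x.1 + t, x.2 + t ^+ 2))); last first.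
  by move=> t s [/addrI].
apply: eq_card => y; rewrite inE; apply/idP/imsetP => [/andP[nz /eqP e2]|[t nz ->]].
  exists (y.1 - x.1); first by rewrite inE.
  by rewrite -e2 !(addrC _ (_ - _)) !subrK -surjective_pairing.
by rewrite /parabola /= !(addrC _.1) !(addrC _.2) !addrK eqxx andbT; rewrite !inE in nz.
Qed.

(** A common in-neighbour writes y - z as (s - t, s^2 - t^2). Here s - t is nonzero, since otherwise
    y = z; hence s + t is determined, and so is s because 2 is invertible. *)
Lemma parabola_codegree y z :
  y != z -> (#|[set x | parabola x y && parabola x z]| <= 1)%N.
Proof.
move=> yz; apply/card_le1_eqP => x x'.
rewrite !inE => /andP[/andP[_ /eqP e1] /andP[_ /eqP e2]].
move=> /andP[/andP[_ /eqP e3] /andP[_ /eqP e4]].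
have d_neq0 : y.1 - z.1 != 0.
  apply: contraNneq yz => /subr0_eq d0; apply/eqP.
  move: e1; rewrite d0 -e2 => /addIr e0.
  by rewrite [y]surjective_pairing d0 e0 -surjective_pairing.
have E (w : F * F) : y.2 - w.2 = (y.1 - w.1) ^+ 2 -> z.2 - w.2 = (z.1 - w.1) ^+ 2 ->
    y.2 - z.2 = (y.1 - z.1) * (y.1 + z.1 - 2%:R * w.1).
  move=> f1 f2; rewrite (_ : y.2 - z.2 = (y.2 - w.2) - (z.2 - w.2)); last by ring.
  by rewrite f1 f2; ring.
have := E _ e3 e4; rewrite (E _ e1 e2) => /(mulfI d_neq0)/addrI/oppr_inj/(mulfI two_neq0) E1.
rewrite [x]surjective_pairing [x']surjective_pairing E1; congr pair.
by move: e1; rewrite E1 -e3 => /addrI/oppr_inj.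
Qed.

(* Second moment of the number f x of out-neighbours of x in B: the sum of    *)
(* (q f - |B|)^2 over all x is at least |A| |B|^2, because f vanishes on A.   *)
Lemma parabola_mixing A B :
    (forall x y, x \in A -> y \in B -> ~~ parabola x y) ->
  (#|A| * #|B| <= #|F| ^ 3 + 2 * #|B| * #|F|)%N.
Proof.
move=> noAB; set q := #|F|; set b := #|B|.
have q_gt0 : (0 < q)%N by apply/card_gt0P; exists 0.
pose f x := (\sum_(y in B) parabola x y)%N.
have fA x : x \in A -> f x = 0%N.
  by move=> xA; apply: big1 => y yB; rewrite (negPf (noAB _ _ xA yB)).
have sum1 : (\sum_x f x = b * q.-1)%N.
  rewrite exchange_big /= (eq_bigr (fun=> q.-1)) ?sum_nat_const // => y _.
  rewrite -(card_parabola_pred y) -sum1dep_card [RHS]big_mkcond.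
  by apply: eq_bigr => x _; case: parabola.
(* The sum of squares counts common in-neighbours of pairs (y, z): q - 1 for y = z and at most 1
   otherwise. *)
have sum2 : (\sum_x f x ^ 2 <= b * (q.-1 + b))%N.
  have -> : (\sum_x f x ^ 2 = \sum_(y in B) \sum_(z in B)
      #|[set x | parabola x y && parabola x z]|)%N.
    under eq_bigr => x _ do rewrite -mulnn big_distrl /=; rewrite exchange_big /=.
    apply: eq_bigr => y _.
    under eq_bigr => x _ do rewrite big_distrr /=; rewrite exchange_big /=.
    apply: eq_bigr => z _; rewrite -sum1dep_card [RHS]big_mkcond.
    by apply: eq_bigr => x _; do 2!case: parabola.
  rewrite -sum_nat_const; apply: leq_sum => y yB.
  rewrite (bigD1 y) //= leq_add //.
    rewrite -(card_parabola_pred y) subset_leq_card //.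
    by apply/subsetP => x; rewrite !inE => /andP[].
  rewrite -[b]sum1_card [X in (_ <= X)%N](bigD1 y) //= (leq_trans _ (leq_addl _ _)) //.
  by apply: leq_sum => z /andP[_ zy]; rewrite parabola_codegree // eq_sym.
have [->|b_gt0] := posnP b; first by rewrite muln0.
rewrite -(leq_pmul2r b_gt0).
(* The deviations q f - b can be negative, so the computation takes place in [int]. *)
have lower : (#|A| * b ^ 2)%:R <= \sum_x (q%:R * (f x)%:R - b%:R) ^+ 2 :> int.
  rewrite (bigID (mem A)) /= -[leLHS]addr0 lerD ?sumr_ge0 => // [|x _]; last exact: sqr_ge0.
  rewrite (eq_bigr (fun=> b%:R ^+ 2)) => [|x xA]; last by rewrite fA // mulr0 sub0r sqrrN.
  by rewrite sumr_const natrM natrX mulr_natl.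
have upper : \sum_x (q%:R * (f x)%:R - b%:R) ^+ 2 =
    q%:R ^+ 2 * (\sum_x f x ^ 2)%N%:R - 2%:R * q%:R * b%:R * (\sum_x f x)%N%:R
    + q%:R ^+ 2 * b%:R ^+ 2 :> int.
  rewrite !natr_sum !mulr_sumr -sumrB.
  have -> : q%:R ^+ 2 * b%:R ^+ 2 = \sum_(x : F * F) b%:R ^+ 2 :> int.
    by rewrite sumr_const card_prod -[RHS]mulr_natl natrM expr2.
  by rewrite -big_split /=; apply: eq_bigr => x _; rewrite natrX; ring.
(* With both moments inserted, the right-hand side is at most b (q^2 (q - 1) + 2 q b). *)
move: lower; rewrite upper sum1 {upper}.
move: sum2 q_gt0; move: (\sum_x _)%N #|A| => S c le_S q_gt0.
have := leq_mul (leqnn (q ^ 2)) le_S.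
rewrite !natz !expnS !expn0 !muln1 !exprS !expr0 !mulr1.
have : q = q.-1.+1 by rewrite prednK.
move: q.-1 => p ->; lia.
Qed.
End Parabola.

(** * Independent sets and oriented products *)

Section IndependentSets.
Variables (V : finType) (e : rel V).
Implicit Type S : {set V}.

Lemma independentP S :
  reflect (forall x y, x \in S -> y \in S -> ~~ e x y) (independent e S).
Proof.
apply: (iffP forall_inP) => [H x y xS yS|H x xS]; first exact: (forall_inP (H x xS)).
by apply/forall_inP => y; apply: H.
Qed.

Lemma leq_IS S : independent e S -> #|S| <= IS e.
Proof. exact: (@leq_bigmax_cond _ _ (fun S : {set V} => #|S|)). Qed.

Lemma IS_witness : exists2 S, independent e S & #|S| = IS e.
Proof.
have ind0 : 0 < #|[pred S | independent e S]|.
  by apply/card_gt0P; exists set0; apply/independentP => x y; rewrite inE.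
have [S indS E] := eq_bigmax_cond (fun S : {set V} => #|S|) ind0.
by exists S.
Qed.

Lemma IS_le_card : IS e <= #|V|.
Proof. by apply/bigmax_leqP => S _; apply: max_card. Qed.

Lemma degree_le_max x : #|[set y | e x y]| <= max_degree e.
Proof. exact: leq_bigmax. Qed.

(** A maximum independent set is dominating, so its closed neighbourhoods, each of size at most D +
    1, cover V. *)
Lemma card_le_IS_degree : simple_graph e -> #|V| <= IS e * (max_degree e).+1.
Proof.
move=> [sym_e irr_e]; have [S indS cardS] := IS_witness.
have cover : [set: V] \subset \bigcup_(x in S) (x |: [set y | e x y]).
  apply/subsetP => y _; apply/bigcupP.
  have [yS|yS] := boolP (y \in S); first by exists y => //; rewrite setU11.
  have [/existsP[x /andP[xS exy]]|noN] := boolP [exists x, (x \in S) && e x y].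
    by exists x => //; rewrite !inE exy orbT.
  rewrite negb_exists in noN; move/forallP: noN => noN.
  have : independent e (y |: S).
    apply/independentP => u v; rewrite !inE.
    case/orP=> [/eqP->|uS] /orP[/eqP->|vS]; rewrite ?irr_e //.
    - by have := noN v; rewrite vS sym_e.
    - by have := noN u; rewrite uS.
    by move/independentP: indS; apply.
  by move/leq_IS; rewrite cardsU1 yS add1n cardS ltnn.
rewrite -cardsT (leq_trans (subset_leq_card cover)) // -cardS -sum_nat_const.
apply: (@leq_trans (\sum_(x in S) #|x |: [set y | e x y]|)).
  apply: (big_ind2 (fun (A : {set V}) k => #|A| <= k)) => // [|A i B j Ai Bj].
    by rewrite cards0.
  by rewrite (leq_trans (leq_card_setU A B)) // leq_add.
apply: leq_sum => x _; by rewrite cardsU1 inE irr_e add1n ltnS degree_le_max.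
Qed.
End IndependentSets.

Section OrientedProduct.
Variables (n : nat) (X : finType) (e : rel 'I_n) (r : rel X).

(** Orienting each edge of [e] from its smaller to its larger end turns the asymmetric [r] into a
    symmetric relation. *)
Definition oriented_prod : rel ('I_n * X) := fun a b =>
  e a.1 b.1 && (if a.1 < b.1 then r a.2 b.2 else r b.2 a.2).

Lemma oriented_prod_simple : simple_graph e -> simple_graph oriented_prod.
Proof.
move=> [sym_e irr_e]; split=> [[u x] [v y]|[u x]]; rewrite /oriented_prod /= ?irr_e //.
rewrite sym_e; case: (ltngtP u v) => // /ord_inj ->; by rewrite irr_e.
Qed.

(** A triangle lies over a triangle of [e]; sorting its three vertices gives a transitive triple of
    [r]. *)
Lemma oriented_prod_triangle_free :
    simple_graph e -> (forall x y z, r x y -> r y z -> ~~ r x z) ->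
  triangle_free oriented_prod.
Proof.
move=> [sym_e irr_e] free_r [|[u x] [|[v y] [|[w z] []]]] // /andP[].
rewrite /= andbT /oriented_prod /= => /and3P[/andP[euv ruv] /andP[evw rvw] /andP[ewu rwu]] _.
have neq (i j : 'I_n) : e i j -> (i == j :> nat) = false.
  by move=> eij; apply: contraTF eij => /eqP/ord_inj->; rewrite irr_e.
move: ruv rvw rwu (neq _ _ euv) (neq _ _ evw) (neq _ _ ewu).
case: (ltngtP u v) => // uv; case: (ltngtP v w) => // vw; case: (ltngtP w u) => // wu.
(* Two of the eight order patterns are cyclic and absurd; in the six others a different pair of
   edges composes to the third. *)
all: move=> r1 r2 r3 _ _ _; try by lia.
all: by first [ have := free_r _ _ _ r1 r2; rewrite r3 | have := free_r _ _ _ r2 r3; rewrite r1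
  | have := free_r _ _ _ r3 r1; rewrite r2 | have := free_r _ _ _ r2 r1; rewrite r3
  | have := free_r _ _ _ r3 r2; rewrite r1 | have := free_r _ _ _ r1 r3; rewrite r2 ].
Qed.

Lemma oriented_prod_IS_ge : IS e * #|X| <= IS oriented_prod.
Proof.
have [S indS <-] := IS_witness e; rewrite -cardsT -cardsX; apply: leq_IS.
apply/independentP => [[u x] [v y]]; rewrite !inE !andbT => uS vS.
by rewrite negb_and (independentP _ _ indS).
Qed.

(** The heavy fibres lie over an independent set [U] of [e] and hold at most IS(e) |X| points. Each
    of the n or fewer light fibres holds at most |X| / m. Both sides are multiplied by m to stay in
    the naturals. *)
Lemma oriented_prod_IS_le (m : nat) :
    simple_graph e ->
    (forall A B : {set X}, #|X| < m * #|A| -> #|X| < m * #|B| ->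
       exists x y, [/\ x \in A, y \in B & r x y]) ->
  IS oriented_prod * m <= IS e * #|X| * m + n * #|X|.
Proof.
move=> [sym_e irr_e] mixing; have [S indS <-] := IS_witness oriented_prod.
pose fib u := [set x | (u, x) \in S].
have cardS : #|S| = \sum_u #|fib u|.
  rewrite -sum1_card (eq_bigl (fun p : 'I_n * X => (p.1, p.2) \in S)); last by case.
  rewrite -(pair_big_dep xpredT (fun u x => (u, x) \in S) (fun _ _ => 1)) /=.
  by apply: eq_bigr => u _; rewrite -sum1dep_card.
pose U := [set u | #|X| < m * #|fib u|].
have indU : independent e U.
  apply/independentP => u v; rewrite !inE => Uu Uv; apply/negP => euv.
  wlog lt_uv : u v Uu Uv euv / u < v.
    move=> IH; case: (ltngtP u v) => [|lt_vu|/ord_inj uv]; first exact: IH euv.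
      by apply: IH Uv Uu _ lt_vu; rewrite sym_e.
    by rewrite uv irr_e in euv.
  have [x [y [xu yv rxy]]] := mixing _ _ Uu Uv.
  rewrite !inE in xu yv.
  by have := independentP _ _ indS _ _ xu yv; rewrite /oriented_prod /= euv lt_uv rxy.
rewrite cardS (bigID (mem U)) /= mulnDl leq_add //.
  rewrite leq_mul2r (leq_trans _ (leq_mul (leq_IS indU) (leqnn _))) ?orbT //.
  by rewrite -sum_nat_const leq_sum // => u _; apply: max_card.
rewrite big_distrl /= -[in X in _ <= X](card_ord n) -sum_nat_const.
rewrite [X in _ <= X](bigID (mem U)) /= (leq_trans _ (leq_addl _ _)) //.
by apply: leq_sum => u; rewrite inE -leqNgt mulnC.
Qed.

Lemma oriented_prod_degree (d : nat) :
    (forall x, #|[set y | r x y]| <= d) -> (forall y, #|[set x | r x y]| <= d) ->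
  max_degree oriented_prod <= max_degree e * d.
Proof.
move=> out_d in_d; apply/bigmax_leqP => [[u x] _].
apply: leq_trans (leq_mul (degree_le_max e u) (leqnn d)).
rewrite -sum1dep_card (eq_bigl (fun p : 'I_n * X =>
  e u p.1 && (if u < p.1 then r x p.2 else r p.2 x))) //.
rewrite -(pair_big_dep (fun v => e u v)
  (fun v y => if u < v then r x y else r y x) (fun _ _ => 1)) /=.
rewrite -sum_nat_const [X in _ <= X](eq_bigl (e u)); last by move=> v; rewrite inE.
apply: leq_sum => v _; rewrite sum1dep_card.
by case: (u < v).
Qed.
End OrientedProduct.

(** * Transport of the graph invariants along a bijection *)

Section Pullback.
Variables (V W : finType) (h : V -> W) (e : rel W).
Hypothesis bij_h : bijective h.
Let inj_h : injective h := bij_inj bij_h.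
Local Notation e' := (fun x y => e (h x) (h y)).

Lemma pullback_simple : simple_graph e -> simple_graph e'.
Proof. by move=> [sym_e irr_e]; split=> [x y|x]; [apply: sym_e | apply: irr_e]. Qed.

Lemma pullback_triangle_free : triangle_free e -> triangle_free e'.
Proof.
move=> tf c /andP[cyc_c uniq_c]; rewrite -(size_map h); apply: tf.
by rewrite /ucycle /ucycleb cycle_map cyc_c map_inj_uniq.
Qed.

Lemma pullback_IS : IS e' = IS e.
Proof.
apply/eqP; rewrite eqn_leq; apply/andP; split.
  have [S /independentP indS <-] := IS_witness e'; rewrite -(card_imset _ inj_h).
  apply: leq_IS; apply/independentP => _ _ /imsetP[x xS ->] /imsetP[y yS ->].
  exact: indS.
have [S /independentP indS <-] := IS_witness e.
rewrite -(on_card_preimset (onW_bij _ bij_h)); apply: leq_IS.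
by apply/independentP => x y; rewrite !inE; apply: indS.
Qed.

Lemma pullback_max_degree : max_degree e' <= max_degree e.
Proof.
apply/bigmax_leqP => x _; apply: leq_trans (degree_le_max e (h x)).
rewrite -(on_card_preimset (onW_bij _ bij_h)); apply: subset_leq_card.
by apply/subsetP => y; rewrite !inE.
Qed.
End Pullback.

(** * The blow-up on an initial segment of the naturals *)

Section Digits.
Variables (n q : nat) (e : rel 'I_n).
Hypotheses (pr_q : prime q) (q_gt2 : 2 < q).

(* The representatives of F_q are the naturals below q; the subtractions      *)
(* q - x1 and q - y2 are never truncated on them.                             *)
Definition gadget (x1 x2 y1 y2 : nat) : bool :=
  let t := (y1 + (q - x1)) %% q in
  (t != 0) && ((x2 + t * t + (q - y2)) %% q == 0).

Lemma natr_Fp_eq0 k : ((k%:R : 'F_q) == 0)%R = (k %% q == 0).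
Proof. by rewrite -(dvdn_pcharf (pchar_Fp pr_q)). Qed.

Lemma natr_Fp_mod k : ((k %% q)%N%:R = k%:R :> 'F_q)%R.
Proof. by apply: val_inj; rewrite /= !val_Fp_nat ?modn_mod. Qed.

Lemma natr_Fp_sub k : k <= q -> ((q - k)%N%:R = - k%:R :> 'F_q)%R.
Proof. by move=> le_kq; rewrite natrB // pchar_Fp_0 // sub0r. Qed.

Lemma gadgetE (x1 x2 y1 y2 : nat) : x1 < q -> y2 < q ->
  gadget x1 x2 y1 y2 = @parabola 'F_q (x1%:R, x2%:R)%R (y1%:R, y2%:R)%R.
Proof.
move=> lt_x1 lt_y2; rewrite /gadget /parabola /=.
have Et : (((y1 + (q - x1)) %% q)%N%:R = y1%:R - x1%:R :> 'F_q)%R.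
  by rewrite natr_Fp_mod natrD natr_Fp_sub // ltnW.
rewrite -Et natr_Fp_eq0 modn_mod; congr (_ && _).
rewrite -natr_Fp_eq0 !natrD natrM natr_Fp_sub ?(ltnW lt_y2) // expr2.
by rewrite subr_eq0 subr_eq eq_sym addrC.
Qed.

Definition blowup_bit (A : nat -> nat -> bool) (u x1 x2 v y1 y2 : nat) : bool :=
  A u v && (if u < v then gadget x1 x2 y1 y2 else gadget y1 y2 x1 x2).

(** The vertex (u, x1, x2) has the number (u q + x1) q + x2, which is the order in which nested
    loops over u, x1, x2 visit it. *)
Definition blowup (A : nat -> nat -> bool) (i j : nat) : bool :=
  blowup_bit A (i %/ q %/ q) (i %/ q %% q) (i %% q)
               (j %/ q %/ q) (j %/ q %% q) (j %% q).

Lemma top_digit_lt (i : 'I_(n * q * q)) : i %/ q %/ q < n.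
Proof. by rewrite !ltn_divLR ?prime_gt0. Qed.

Definition digits (i : 'I_(n * q * q)) : 'I_n * ('F_q * 'F_q) :=
  (Ordinal (top_digit_lt i), ((i %/ q %% q)%N%:R, (i %% q)%N%:R)%R).

Lemma digits_bij : bijective digits.
Proof.
apply: inj_card_bij; last first.
  by rewrite !card_prod (card_Fp pr_q) !card_ord mulnA.
have val_q k : (k%:R : 'F_q)%R = k %% q :> nat by rewrite val_Fp_nat.
move=> i j [top /(congr1 (@nat_of_ord _)) mid /(congr1 (@nat_of_ord _)) low].
move: mid low; rewrite !val_q !modn_mod => mid low; apply: ord_inj.
by rewrite (divn_eq i q) (divn_eq j q) low (divn_eq (i %/ q) q) mid top -divn_eq.
Qed.

Lemma blowupE (A : nat -> nat -> bool) (i j : 'I_(n * q * q)) :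
    (forall u v : 'I_n, A u v = e u v) ->
  blowup A i j = oriented_prod e (@parabola 'F_q) (digits i) (digits j).
Proof.
move=> EA; have q_gt0 := prime_gt0 pr_q.
rewrite /blowup /blowup_bit /oriented_prod /= -EA /=.
by rewrite !gadgetE ?ltn_pmod.
Qed.

Lemma two_Fp_neq0 : (2%:R != 0 :> 'F_q)%R.
Proof. by rewrite natr_Fp_eq0 modn_small. Qed.

(** Otherwise q^4 < m^2 |A| |B| <= m^2 (q^3 + 2 |B| q) <= 3 m^2 q^3 <= q^4, using |B| <= q^2. *)
Lemma parabola_large_sets (m : nat) (A B : {set 'F_q * 'F_q}) :
    3 * m ^ 2 <= q -> #|{: 'F_q * 'F_q}| < m * #|A| -> #|{: 'F_q * 'F_q}| < m * #|B| ->
  exists x y, [/\ x \in A, y \in B & parabola x y].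
Proof.
move=> le_q; have := max_card B; rewrite card_prod card_Fp // => leB ltA ltB.
case: (boolP [exists x in A, exists y in B, parabola x y]) => [|noAB].
  by case/exists_inP=> x xA /exists_inP[y yB xy]; exists x, y.
have : #|A| * #|B| <= #|'F_q| ^ 3 + 2 * #|B| * #|'F_q|.
  apply: parabola_mixing => [|x y xA yB]; first exact: two_Fp_neq0.
  apply: contra noAB => xy; apply/exists_inP; exists x => //.
  by apply/exists_inP; exists y.
rewrite card_Fp // => leAB; exfalso.
have := leq_mul ltA ltB; have := leq_mul (leqnn (m * m)) leAB.
have := leq_mul le_q (leqnn (q * q * q)).
have := leq_mul leB (leqnn (q * m * m)).
rewrite !expnS expn0; nia.
Qed.

Lemma blowup_correct (A : nat -> nat -> bool) (m : nat)
    (e' := fun i j : 'I_(n * q * q) => blowup A i j) :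
    simple_graph e -> (forall u v : 'I_n, A u v = e u v) -> 3 * m ^ 2 <= q ->
  [/\ simple_graph e' /\ triangle_free e',
      IS e * q ^ 2 <= IS e',
      IS e' * m <= IS e * q ^ 2 * m + n * q ^ 2 &
      max_degree e' <= max_degree e * q].
Proof.
move=> simple_e EA le_q.
pose e2 : rel 'I_(n * q * q) := fun i j => oriented_prod e (@parabola 'F_q) (digits i) (digits j).
have Ee : e' =2 e2 by move=> i j; apply: blowupE.
have cardX : #|{: 'F_q * 'F_q}| = q ^ 2 by rewrite card_prod card_Fp // mulnn.
have -> : IS e' = IS e2.
  apply: eq_bigl => S; apply/independentP/independentP => ind x y xS yS.
    by rewrite -Ee ind.
  by rewrite Ee ind.
have -> : max_degree e' = max_degree e2.
  by apply: eq_bigr => x _; apply: eq_card => y; rewrite !inE Ee.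
rewrite (pullback_IS _ digits_bij) -cardX.
split.
- have [sym irr] := pullback_simple digits (oriented_prod_simple (@parabola 'F_q) simple_e).
  split; first by split=> [x y|x]; rewrite !Ee; [apply: sym | apply: irr].
  move=> c; rewrite /ucycle /ucycleb (eq_cycle Ee).
  apply: (pullback_triangle_free digits_bij).
  exact: oriented_prod_triangle_free simple_e (parabola_sumfree two_Fp_neq0).
- exact: oriented_prod_IS_ge.
- by apply: oriented_prod_IS_le => // B1 B2; apply: parabola_large_sets.
apply: leq_trans (pullback_max_degree _ digits_bij) _.
apply: oriented_prod_degree => x.
  by rewrite card_parabola_succ card_Fp // leq_pred.
by rewrite card_parabola_pred card_Fp // leq_pred.
Qed.
End Digits.

(** * Execution of commands *)

Fixpoint writes (c : cmd) : seq nat :=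
  match c with
  | Assign i _ => [:: i]
  | Store _ _ | Output _ => [::]
  | Seq c1 c2 | If _ c1 c2 => writes c1 ++ writes c2
  | While _ c => writes c
  end.

Local Notation "c1 ;; c2" := (Seq c1 c2) (at level 61, right associativity).

Section Run.
Variable mu : nat -> nat.
Implicit Types (c : cmd) (f : nat -> nat) (x : expr) (Q : (nat -> nat) -> Prop).

Definition same_off c f f' := forall r, r \notin writes c -> f' r = f r.

(** A total-correctness triple with time bound t and emitted word w. The memory [mu] is fixed, as
    the program never stores; quantifying over the earlier output [o] and recording [same_off]
    provide the frame conditions. *)
Definition run c f (t : nat) (w : seq nat) Q : Prop :=
  exists t' f', [/\ forall o, exec c (State f mu o) t' (State f' mu (o ++ w)),
                    t' <= t, same_off c f f' & Q f'].

Definition ev f x : nat := eval (State f mu [::]) x.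

Lemma eval_out f x (o : seq nat) : eval (State f mu o) x = ev f x.
Proof. by rewrite /ev; elim: x => //= [y ->|y -> z ->|y -> z ->]. Qed.

Lemma run_weaken c f t t' w Q Q' :
    run c f t w Q -> t <= t' -> (forall f', same_off c f f' -> Q f' -> Q' f') ->
  run c f t' w Q'.
Proof.
move=> [s [f' [E le_s fr Qf]]] le_t QQ'; exists s, f'; split=> //.
  exact: leq_trans le_t.
exact: QQ'.
Qed.

Lemma run_assign i x f t Q :
  cost x < t -> Q (update f i (ev f x)) -> run (Assign i x) f t [::] Q.
Proof.
move=> lt_t Qf; exists (cost x).+1, (update f i (ev f x)); split=> // [o|r].
  by rewrite cats0 -(eval_out f x o); apply: (ExecAssign i x (State f mu o)).
by rewrite inE /update => /negPf->.
Qed.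

Lemma run_output x f t Q : cost x < t -> Q f -> run (Output x) f t [:: ev f x] Q.
Proof.
move=> lt_t Qf; exists (cost x).+1, f; split=> // o.
by rewrite cats1 -(eval_out f x o); apply: (ExecOutput x (State f mu o)).
Qed.

Lemma run_seq t1 Q1 c1 c2 f t w1 w2 Q :
    t1 <= t -> run c1 f t1 w1 Q1 ->
    (forall f1, same_off c1 f f1 -> Q1 f1 -> run c2 f1 (t - t1) w2 Q) ->
  run (c1 ;; c2) f t (w1 ++ w2) Q.
Proof.
move=> le_t [s1 [f1 [E1 le1 fr1 Q1f]]] /(_ f1 fr1 Q1f)[s2 [f2 [E2 le2 fr2 Qf]]].
exists (s1 + s2), f2; split=> // [o||r]; last 1 first.
- by rewrite mem_cat negb_or => /andP[/fr1<- /fr2].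
- by apply: ExecSeq (E1 o) _; rewrite catA; apply: E2.
lia.
Qed.

Lemma run_assign_seq i x c f t w Q :
    cost x < t -> run c (update f i (ev f x)) (t - (cost x).+1) w Q ->
  run (Assign i x ;; c) f t w Q.
Proof.
move=> lt_t rc; rewrite -[w]cat0s.
apply: (@run_seq (cost x).+1 (eq^~ (update f i (ev f x)))) => //.
  exact: run_assign.
by move=> f1 _ ->.
Qed.

Lemma run_if x c1 c2 f t w Q :
    cost x < t ->
    run (if ev f x == 0 then c2 else c1) f (t - (cost x).+1) w Q ->
  run (If x c1 c2) f t w Q.
Proof.
move=> lt_t; case: eqVneq => zx [s [f' [E le_s fr Qf]]].
  exists (cost x + s).+1, f'; split=> // [o||r]; last 1 first.
  - by rewrite mem_cat negb_or => /andP[_ /fr].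
  - by apply: ExecIfFalse => //; rewrite eval_out.
  by lia.
exists (cost x + s).+1, f'; split=> // [o||r]; last 1 first.
- by rewrite mem_cat negb_or => /andP[/fr].
- by apply: ExecIfTrue => //; rewrite eval_out.
by lia.
Qed.

(** The invariant is indexed by the number of completed passes, and J is the exact total, so that
    both time and output add up over the passes. *)
Lemma run_while (J d : nat) (w : nat -> seq nat) (I : nat -> (nat -> nat) -> Prop)
    x c f t :
    J * (d + (cost x).+1) + (cost x).+1 <= t ->
    I 0 f ->
    (forall j f', j < J -> same_off c f f' -> I j f' ->
       ev f' x != 0 /\ run c f' d (w j) (I j.+1)) ->
    (forall f', same_off c f f' -> I J f' -> ev f' x = 0) ->
  run (While x c) f t (flatten [seq w j | j <- iota 0 J]) (I J).
Proof.
move=> le_t I0 body stop.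
suff key k : forall j f0, j + k = J -> I j f0 -> same_off c f f0 -> exists s f',
    [/\ forall o, exec (While x c) (State f0 mu o) s
          (State f' mu (o ++ flatten [seq w i | i <- iota j k])),
        s <= k * (d + (cost x).+1) + (cost x).+1, same_off c f f' & I J f'].
  have [s [f' [E le_s fr If]]] := key J 0 f (add0n J) I0 (fun r _ => erefl).
  by exists s, f'; split=> //; apply: leq_trans le_t.
elim: k => [|k IHk] j f0 eJ Ij fr0.
  rewrite addn0 in eJ; subst j.
  exists (cost x).+1, f0; split=> // o.
  by rewrite /= cats0; apply: ExecWhileFalse; rewrite eval_out stop.
have lt_j : j < J by lia.
have [nz [s1 [f1 [E1 le1 fr1 I1]]]] := body _ _ lt_j fr0 Ij.
have fr : same_off c f f1 by move=> r Hr; rewrite fr1 ?fr0.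
have [|s2 [f2 [E2 le2 fr2 I2]]] := IHk j.+1 f1 _ I1 fr; first by lia.
exists (cost x + s1 + s2).+1, f2; split=> //; last by lia.
move=> o; apply: ExecWhileTrue (E1 o) _; first by rewrite eval_out.
by rewrite /= catA; apply: E2.
Qed.

Definition For (i k : nat) c : cmd :=
  Assign i (Const 0) ;;
  While (Defs.Sub (Reg k) (Reg i)) (c ;; Assign i (Add (Reg i) (Const 1))).

(** The 8 pays for one guard and one increment, the 6 for the initial assignment and the final
    failing guard. Stability of [I] under updates of i lets it survive the increment. *)
Lemma run_for (d : nat) (w : nat -> seq nat) (I : nat -> (nat -> nat) -> Prop)
    (K i k : nat) c f t :
    f k = K -> K * (d + 8) + 6 <= t ->
    [&& i != k, i \notin writes c & k \notin writes c] ->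
    (forall j f' v, I j f' -> I j (update f' i v)) ->
    I 0 f ->
    (forall j f', j < K -> f' i = j -> same_off (For i k c) f f' -> I j f' ->
       run c f' d (w j) (I j.+1)) ->
  run (For i k c) f t (flatten [seq w j | j <- iota 0 K]) (I K).
Proof.
move=> fk le_t /and3P[ik ic kc] stable I0 body.
apply: run_assign_seq; first by rewrite /=; lia.
rewrite /ev /=.
have upd_i (g : nat -> nat) v : update g i v i = v by rewrite /update eqxx.
have upd_k (g : nat -> nat) v : update g i v k = g k by rewrite /update eq_sym (negPf ik).
have fK f' : same_off (c ;; Assign i (Add (Reg i) (Const 1))) (update f i 0) f' -> f' k = K.
  move=> fr; rewrite fr ?upd_k //= mem_cat negb_or kc inE eq_sym.
  by rewrite ik.
apply: run_weaken (_ : run _ _ _ _ (fun f' => f' i = K /\ I K f')) (leqnn _) _; last first.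
  by move=> f' _ [].
apply: (@run_while K (d + 4) w (fun j f' => f' i = j /\ I j f')).
- by rewrite /=; lia.
- by rewrite upd_i; split=> //; apply: stable.
- move=> j f' lt_j fr [f'i Ij]; rewrite /ev /= (fK _ fr) f'i; split; first by lia.
  rewrite -[w j]cats0; apply: (@run_seq d (I j.+1)); first by lia.
    apply: body => // r; rewrite /= inE mem_cat => Hr.
    rewrite fr /update; first by case: eqVneq Hr.
    by rewrite /= mem_cat inE; move: Hr; rewrite inE orbA orbC orbA orbb orbC.
  move=> f1 fr1 I1; apply: run_assign; first by rewrite /=; lia.
  rewrite upd_i /ev /= fr1 // f'i addn1; split=> //; exact: stable.
move=> f' fr [f'i _]; rewrite /ev /= (fK _ fr) f'i subnn //.
Qed.

Definition Mul (d k x y : nat) : cmd :=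
  Assign d (Const 0) ;; For k x (Assign d (Add (Reg d) (Reg y))).

Lemma run_mul (d k x y : nat) f t :
    [&& d != k, d != x, d != y, k != x & k != y] -> f x * 12 + 8 <= t ->
  run (Mul d k x y) f t [::] (fun f' => f' d = f x * f y).
Proof.
case/and5P=> dk dx dy kx ky le_t.
apply: run_assign_seq; first by rewrite /=; lia.
set f0 := update _ _ _.
have -> : [::] = flatten [seq [::] | _ <- iota 0 (f x)] :> seq nat.
  by elim: iota.
apply: (@run_for 4 (fun=> [::]) (fun j f' => f' d = j * f y) (f x)).
- by rewrite /f0 /update eq_sym (negPf dx).
- by rewrite /=; lia.
- by rewrite kx /= !inE [k == d]eq_sym dk eq_sym dx.
- by move=> j f' v; rewrite /update (negPf dk).
- by rewrite /f0 /update eqxx.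
move=> j f' lt_j f'k fr Ij; apply: run_assign => //.
rewrite /update eqxx /ev /= Ij fr /f0 /update; first by rewrite eq_sym (negPf dy) mulSn addnC.
by rewrite /= !inE !(eq_sym y) (negPf dy) (negPf ky).
Qed.

(** Repeated subtraction; the truncated difference w + 1 - m is nonzero exactly when w >= m. *)
Definition Mod (w m : nat) : cmd :=
  While (Defs.Sub (Add (Reg w) (Const 1)) (Reg m)) (Assign w (Defs.Sub (Reg w) (Reg m))).

Lemma run_mod (w m : nat) f t :
    w != m -> 0 < f m -> f w * 10 + 6 <= t ->
  run (Mod w m) f t [::] (fun f' => f' w = f w %% f m).
Proof.
move=> wm m_gt0 le_t; set J := f w %/ f m.
have -> : [::] = flatten [seq [::] | _ <- iota 0 J] :> seq nat by elim: iota.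
have le_J : J <= f w by apply: leq_div.
have E := divn_eq (f w) (f m); have lt_mod := ltn_pmod (f w) m_gt0.
apply: run_weaken (_ : run _ _ _ _ (fun f' => f' w = f w - J * f m)) (leqnn _) _; last first.
  by move=> f' _ ->; rewrite {1}E addKn.
have fm f' : same_off (Assign w (Defs.Sub (Reg w) (Reg m))) f f' -> f' m = f m.
  by apply; rewrite inE eq_sym.
apply: (@run_while J 4 (fun=> [::]) (fun j f' => f' w = f w - j * f m)).
- by rewrite /=; lia.
- by rewrite subn0.
- move=> j f' lt_j fr Ij; rewrite /ev /= Ij (fm _ fr).
  have : j.+1 * f m <= J * f m by rewrite leq_mul2r lt_j orbT.
  rewrite mulSn => le_j; split; first by rewrite -/J in E; lia.
  apply: run_assign => //; rewrite /update eqxx /ev /= Ij (fm _ fr); lia.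
by move=> f' fr Ij; rewrite /ev /= Ij (fm _ fr); rewrite -/J in E; lia.
Qed.
End Run.

(** * The program *)

Section Program.
Variable mu : nat -> nat.
Implicit Types (c : cmd) (f : nat -> nat).
Local Notation run := (run mu).
(** Addresses 0 and 1 hold a and b, address 2 the number of vertices, and the adjacency matrix
    starts at address 3. *)
Local Notation n := (mu 2).

Lemma run_seq_silent t1 Q1 c1 c2 f t w Q :
    t1 <= t -> run c1 f t1 [::] Q1 ->
    (forall f1, same_off c1 f f1 -> Q1 f1 -> run c2 f1 (t - t1) w Q) ->
  run (c1 ;; c2) f t w Q.
Proof. exact: run_seq. Qed.

Lemma flatten_nils (J : nat) : flatten [seq [::] | _ <- iota 0 J] = [::] :> seq nat.
Proof. by elim: iota. Qed.

Lemma run_for_silent (d : nat) (I : nat -> (nat -> nat) -> Prop) (K i k : nat) c f t :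
    f k = K -> K * (d + 8) + 6 <= t ->
    [&& i != k, i \notin writes c & k \notin writes c] ->
    (forall j f' v, I j f' -> I j (update f' i v)) ->
    I 0 f ->
    (forall j f', j < K -> f' i = j -> same_off (For i k c) f f' -> I j f' ->
       run c f' d [::] (I j.+1)) ->
  run (For i k c) f t [::] (I K).
Proof. by move=> *; rewrite -(flatten_nils K); apply: (@run_for _ d (fun=> [::])). Qed.

Lemma run_while_silent (J d : nat) (I : nat -> (nat -> nat) -> Prop) x c f t :
    J * (d + (cost x).+1) + (cost x).+1 <= t ->
    I 0 f ->
    (forall j f', j < J -> same_off c f f' -> I j f' ->
       ev mu f' x != 0 /\ run c f' d [::] (I j.+1)) ->
    (forall f', same_off c f f' -> I J f' -> ev mu f' x = 0) ->
  run (While x c) f t [::] (I J).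
Proof. by move=> *; rewrite -(flatten_nils J); apply: (@run_while _ J d (fun=> [::])). Qed.

Local Notation rn := 0 (only parsing).
Local Notation rD := 1 (only parsing).
Local Notation ri := 2 (only parsing).
Local Notation rj := 3 (only parsing).
Local Notation rs := 4 (only parsing).
Local Notation rp := 5 (only parsing).
Local Notation rk := 6 (only parsing).
Local Notation rt := 7 (only parsing).
Local Notation rac := 8 (only parsing).
Local Notation rq := 9 (only parsing).
Local Notation rfl := 10 (only parsing).
Local Notation rw := 11 (only parsing).
Local Notation ru := 12 (only parsing).
Local Notation rx1 := 13 (only parsing).
Local Notation rx2 := 14 (only parsing).
Local Notation rv := 15 (only parsing).
Local Notation ry1 := 16 (only parsing).
Local Notation ry2 := 17 (only parsing).
Local Notation rT := 18 (only parsing).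
Local Notation rS := 19 (only parsing).
Local Notation rZ := 20 (only parsing).
Local Notation rb := 21 (only parsing).
Local Notation rd1 := 22 (only parsing).
Local Notation rN := 23 (only parsing).

(* rD + (rs - rD) is the maximum of rs and rD, as subtraction is truncated.   *)
Definition max_degree_cmd : cmd :=
  Assign rn (Fetch (Const 2)) ;;
  Assign rD (Const 0) ;;
  For ri rn
    (Assign rs (Const 0) ;;
     For rj rn
       (Mul rp rk ri rn ;;
        Assign rs (Add (Reg rs)
                       (Fetch (Add (Const 3) (Add (Reg rp) (Reg rj)))))) ;;
     Assign rD (Add (Reg rD) (Defs.Sub (Reg rs) (Reg rD)))).

Definition max_row_sum : nat :=
  \max_(0 <= i < n) \sum_(0 <= j < n) mu (3 + (i * n + j)).

Lemma run_max_degree f t :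
    n * (n * (12 * n + 25) + 22) + 11 <= t ->
  run max_degree_cmd f t [::] (fun f' => f' rn = n /\ f' rD = max_row_sum).
Proof.
move=> le_t; apply: run_assign_seq; first by rewrite /=; lia.
apply: run_assign_seq; first by rewrite /=; lia.
set f0 := update _ _ _.
pose I j (f' : nat -> nat) := f' rD = \max_(0 <= i < j) \sum_(0 <= j < n) mu (3 + (i * n + j)).
apply: (run_weaken (t := t - 5) (Q := I n)); last 2 first.
- by rewrite /=; lia.
- by move=> f' fr If; split=> //; rewrite fr.
apply: (@run_for_silent (n * (12 * n + 25) + 14) I n) => //.
- lia.
- by rewrite /I big_nil.
move=> i f' lt_i f'i fr Ii; have f'n : f' rn = n by rewrite fr.
apply: run_assign_seq; first by rewrite /=; lia.
set f1 := update _ _ _.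
apply: (@run_seq_silent (n * (12 * n + 25) + 6)
  (fun g => g rs = \sum_(0 <= j < n) mu (3 + (i * n + j)))).
- by rewrite /=; lia.
- apply: (@run_for_silent (12 * n + 17)
    (fun j g => g rs = \sum_(0 <= j' < j) mu (3 + (i * n + j')))) => //.
  + by lia.
  + by rewrite big_nil.
  move=> j g lt_j gj frg gs.
  apply: (@run_seq_silent (12 * n + 8) (fun g' => g' rp = i * n)).
  + by lia.
  + apply: run_weaken (_ : run _ _ _ _ (fun g' => g' rp = g ri * g rn)) (leqnn _) _.
      apply: run_mul => //; rewrite frg // /f1 /update /= f'i; lia.
    by move=> g' _ ->; rewrite !frg // /f1 /update /= f'i f'n.
  move=> g' frg' g'p; apply: run_assign; first by rewrite /=; lia.
  by rewrite /update /= /ev /= g'p !frg' // gj gs big_nat_recr.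
move=> g frg gs; apply: run_assign; first by rewrite /=; lia.
rewrite /I /update /= /ev /= gs frg // /f1 /update /= big_nat_recr //= -Ii; lia.
Qed.

(** [rt] holds (D + 1) b. Doubling a until it reaches this threshold while quadrupling 3 yields 3
    m^2 for m = 2^k >= (D + 1) b / a, with additions only. *)
Definition double_cmd : cmd :=
  Assign rac (Fetch (Const 0)) ;;
  Assign rq (Const 3) ;;
  While (Defs.Sub (Reg rt) (Reg rac))
    (Assign rac (Add (Reg rac) (Reg rac)) ;;
     Assign rq (Add (Reg rq) (Reg rq)) ;;
     Assign rq (Add (Reg rq) (Reg rq))).

Lemma run_double (k : nat) f t :
    f rt <= 2 ^ k * mu 0 -> (forall j, j < k -> 2 ^ j * mu 0 < f rt) ->
    k * 16 + 9 <= t ->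
  run double_cmd f t [::] (fun f' => f' rq = 3 * 4 ^ k).
Proof.
move=> ge_k lt_k le_t; apply: run_assign_seq; first by rewrite /=; lia.
apply: run_assign_seq; first by rewrite /=; lia.
set f0 := update _ _ _.
apply: (run_weaken (t := t - 5)
  (Q := fun g => g rac = 2 ^ k * mu 0 /\ g rq = 3 * 4 ^ k)); last 2 first.
- by rewrite /=; lia.
- by move=> g _ [].
apply: (@run_while_silent k 12 (fun j g => g rac = 2 ^ j * mu 0 /\ g rq = 3 * 4 ^ j)).
- by rewrite /=; lia.
- by rewrite /f0 /update /= mul1n.
- move=> j g lt_j fr [gac gq]; split.
    by rewrite /ev /= gac fr // /f0 /update /= subn_eq0 -ltnNge lt_k.
  do 2!(apply: run_assign_seq => //); apply: run_assign => //.
  by rewrite /update /= /ev /= /update /= gac gq !expnS; lia.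
by move=> g fr [gac _]; rewrite /ev /= gac fr // /f0 /update /=; apply/eqP; rewrite subn_eq0.
Qed.

(** The flag [rfl] is 1 when a proper divisor was found, so adding it to [rq] advances exactly past
    composites. Assigning 0 to [rw] serves as a skip. *)
Definition prime_cmd : cmd :=
  Assign rfl (Const 1) ;;
  While (Reg rfl)
    (Assign rfl (Const 0) ;;
     For ri rq
       (If (Defs.Sub (Reg ri) (Const 1))
          (Assign rw (Reg rq) ;;
           Mod rw ri ;;
           If (Reg rw) (Assign rw (Const 0)) (Assign rfl (Const 1)))
          (Assign rw (Const 0))) ;;
     Assign rq (Add (Reg rq) (Reg rfl))).

Lemma primeN_has (q : nat) : 1 < q ->
  ~~ prime q = has (fun d => (1 < d) && (d %| q)) (iota 0 q).
Proof.
move=> q_gt1; apply/idP/hasP => [|[d]].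
  case/primePn=> [|[d /andP[lt1d lt_dq] dq]]; first by lia.
  by exists d; [rewrite mem_iota | rewrite lt1d].
rewrite mem_iota => /andP[_ lt_dq] /andP[lt1d dq]; apply/negP => /primeP[_ /(_ d dq)]; lia.
Qed.

(* The loop body runs once for each of f rq, ..., p, hence p - f rq + 1 times. *)
Lemma run_prime (p : nat) f t :
    1 < f rq <= p -> prime p -> (forall r, f rq <= r < p -> ~~ prime r) ->
    (p - f rq).+1 * (p * (10 * p + 25) + 20) + 8 <= t ->
  run prime_cmd f t [::] (fun f' => f' rq = p).
Proof.
set q := f rq; move=> /andP[q_gt1 le_qp] pr_p noprime le_t.
apply: run_assign_seq; first by rewrite /=; lia.
set f0 := update _ _ _.
pose J := (p - q).+1.
(* Pass j tests q + j; the last pass tests p and does not increment, hence the minimum with p. *)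
apply: (run_weaken (t := t - 2)
  (Q := fun g => g rq = minn (q + J) p /\ g rfl = (J < J))); last 2 first.
- by rewrite /=; lia.
- by move=> g _ [-> _]; rewrite /J; lia.
apply: (@run_while_silent J (p * (10 * p + 25) + 18)
  (fun j g => g rq = minn (q + j) p /\ g rfl = (j < J))).
- by rewrite /= /J; lia.
- by rewrite /f0 /update /= /J -/q; split=> //; lia.
- move=> j g lt_j fr [gq gfl]; split; first by rewrite /ev /= gfl lt_j.
  have {}gq : g rq = q + j by rewrite gq /J in lt_j *; lia.
  have le_j : q + j <= p by rewrite /J in lt_j; lia.
  apply: run_assign_seq; first by rewrite /=; lia.
  set g0 := update _ _ _.
  apply: (@run_seq_silent (p * (10 * p + 25) + 6) (fun g' => g' rfl = ~~ prime (q + j))).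
  + by rewrite /=; lia.
  + rewrite primeN_has; last by lia.
    apply: (@run_for_silent (10 * p + 17)
      (fun i g' => g' rfl = has (fun d => (1 < d) && (d %| q + j)) (iota 0 i))) => //.
    * by rewrite leq_add2r; apply: leq_mul => //; lia.
    move=> i g' lt_i g'i frg' g'fl.
    have g'q : g' rq = q + j by rewrite frg'.
    apply: run_if; first by rewrite /=; lia.
    have Ei : iota 0 i.+1 = rcons (iota 0 i) i by rewrite -addn1 iotaD cats1.
    cbv beta; rewrite Ei has_rcons orbC.
    have -> : (ev mu g' (Defs.Sub (Reg ri) (Const 1)) == 0) = ~~ (1 < i).
      by rewrite /ev /= g'i subn_eq0 leqNgt.
    case: (ltnP 1 i) => /= [lt1i|_]; last first.
      by rewrite orbF; apply: run_assign => //=; lia.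
    apply: run_assign_seq; first by rewrite /=; lia.
    apply: (@run_seq_silent (10 * p + 6) (fun h => h rw = (q + j) %% i)).
    * by rewrite /=; lia.
    * apply: run_weaken (run_mod _ _ _ (leqnn _)) _ _ => //.
      - by rewrite /update /= g'i; lia.
      - by rewrite /update /= /ev /= g'q; lia.
      by move=> h _ ->; rewrite /update /= /ev /= g'q g'i.
    move=> h frh hw; apply: run_if; first by rewrite /=; lia.
    rewrite /ev /= hw /dvdn; case: eqVneq => _; apply: run_assign => //=; try by lia.
      by rewrite /update /= orbT.
    by rewrite /update /= orbF frh // /update /=.
  move=> g1 fr1 g1fl; apply: run_assign; first by rewrite /=; lia.
  rewrite /update /= /ev /= fr1 // g1fl /g0 /update /= gq.
  case: (ltnP (q + j) p) => [lt_jp|ge_jp].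
    rewrite noprime ?lt_jp ?leq_addr // /J; split; first by lia.
    by congr nat_of_bool; lia.
  have -> : q + j = p by lia.
  by rewrite pr_p /J; split; first lia; congr nat_of_bool; lia.
by move=> g _ [_ gfl]; rewrite /ev /= gfl ltnn.
Qed.

Definition test_cmd (x1 x2 y1 y2 : nat) : cmd :=
  Assign rT (Add (Reg y1) (Defs.Sub (Reg rq) (Reg x1))) ;;
  Mod rT rq ;;
  Mul rS rk rT rT ;;
  Assign rZ (Add (Add (Reg x2) (Reg rS)) (Defs.Sub (Reg rq) (Reg y2))) ;;
  Mod rZ rq ;;
  If (Reg rT) (If (Reg rZ) (Output (Const 0)) (Output (Const 1)))
              (Output (Const 0)).

(** The registers x2 and y2 are read after the scratch registers have changed, hence the freshness
    condition. The bounds on y1 and x2 limit the numbers reduced by [Mod], whose time is linear in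
    their value. *)
Lemma run_test (x1 x2 y1 y2 : nat) f t :
    let q := f rq in
    all (fun r => r \notin [:: rT; rS; rk]) [:: x2; y2] ->
    f y1 < q -> f x2 < q -> 10 * q ^ 2 + 52 * q + 40 <= t ->
  run (test_cmd x1 x2 y1 y2) f t [:: nat_of_bool (gadget q (f x1) (f x2) (f y1) (f y2))]
    (fun=> True).
Proof.
move=> q /and3P[x2_fresh y2_fresh _] lt_y1 lt_x2 le_t.
have q_gt0 : 0 < q by lia.
apply: run_assign_seq; first by rewrite /=; lia.
set f0 := update _ _ _; set T := (f y1 + (q - f x1)) %% q.
have lt_T : T < q by rewrite ltn_pmod.
apply: (@run_seq_silent (20 * q + 6) (fun g => g rT = T)).
- by rewrite /=; lia.
- apply: run_weaken (run_mod _ _ _ (leqnn _)) _ _ => //.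
  by rewrite /f0 /update /= /ev /= -/q; lia.
move=> f1 fr1 f1T.
apply: (@run_seq_silent (12 * q + 8) (fun g => g rS = T * T)).
- by rewrite /=; lia.
- apply: run_weaken (run_mul _ _ (leqnn _)) _ _ => //.
    by rewrite f1T; lia.
  by move=> g _ ->; rewrite f1T.
move=> f2 fr2 f2S.
have f2r r : r \notin [:: rT; rS; rk] -> f2 r = f r.
  rewrite !inE !negb_or => /and3P[r1 r2 r3].
  have r_mul : r \notin writes (Mul rS rk rT rT) by rewrite /= !inE !negb_or r2 r3.
  by rewrite fr2 // fr1 ?inE // /f0 /update (negPf r1).
have f2T : f2 rT = T by rewrite fr2.
apply: run_assign_seq; first by rewrite /=; lia.
set f3 := update _ _ _; set Z := f x2 + T * T + (q - f y2).
have f3Z : f3 rZ = Z by rewrite /f3 /update /= /ev /= f2S !f2r.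
have le_Z : Z <= q ^ 2 + 2 * q.
  have := leq_mul (ltnW lt_T) (ltnW lt_T); rewrite mulnn; lia.
apply: (@run_seq_silent (10 * (q ^ 2 + 2 * q) + 6) (fun g => g rZ = Z %% q)).
- by rewrite /=; lia.
- apply: run_weaken (run_mod _ _ _ (leqnn _)) _ _ => //.
  + by rewrite /f3 /update /= f2r.
  + by rewrite f3Z; lia.
  by move=> g _ ->; rewrite f3Z /f3 /update /= f2r.
move=> f4 fr4 f4Z; have f4T : f4 rT = T by rewrite fr4.
rewrite /gadget -/T -/Z.
apply: run_if; first by rewrite /=; lia.
rewrite /ev /= f4T; case: eqVneq => _ /=; first by apply: run_output => //=; lia.
apply: run_if; first by rewrite /=; lia.
rewrite /ev /= f4Z; case: eqVneq => _ /=; by apply: run_output => //=; lia.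
Qed.

Definition bit_cmd : cmd :=
  Mul rp rk ru rn ;;
  If (Fetch (Add (Const 3) (Add (Reg rp) (Reg rv))))
    (If (Defs.Sub (Reg rv) (Reg ru)) (test_cmd rx1 rx2 ry1 ry2)
                                     (test_cmd ry1 ry2 rx1 rx2))
    (Output (Const 0)).

Definition input_adj (u v : nat) : bool := mu (3 + (u * n + v)) != 0.

Lemma run_bit f t :
    let q := f rq in
    f rn = n -> f ru < n -> all (fun r => f r < q) [:: rx1; rx2; ry1; ry2] ->
    12 * n + 10 * q ^ 2 + 52 * q + 60 <= t ->
  run bit_cmd f t
    [:: nat_of_bool (blowup_bit q input_adj (f ru) (f rx1) (f rx2) (f rv) (f ry1) (f ry2))]
    (fun=> True).
Proof.
move=> q fn lt_u /and5P[lt_x1 lt_x2 lt_y1 lt_y2 _] le_t.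
apply: (@run_seq_silent (12 * n + 8) (fun g => g rp = f ru * n)).
- by rewrite /=; lia.
- apply: run_weaken (run_mul _ _ (leqnn _)) _ _ => //; first by lia.
  by move=> g _ ->; rewrite fn.
move=> f1 fr1 f1p; apply: run_if; first by rewrite /=; lia.
rewrite /ev /= f1p fr1 // /blowup_bit /input_adj.
case: eqVneq => _; first by apply: run_output => //=; lia.
apply: run_if; first by rewrite /=; lia.
rewrite /ev /= !fr1 //= subn_eq0 leqNgt; case: ltnP => _ /=.
  have := @run_test rx1 rx2 ry1 ry2 f1; rewrite /= !fr1 //; apply=> //.
  by rewrite -/q; lia.
have := @run_test ry1 ry2 rx1 rx2 f1; rewrite /= !fr1 //; apply=> //.
by rewrite -/q; lia.
Qed.

Definition loop_time (K d : nat) := K * (d + 8) + 6.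

Lemma run_loop (d : nat) (w : nat -> seq nat) (K i k : nat) c f :
    f k = K -> [&& i != k, i \notin writes c & k \notin writes c] ->
    (forall j f', j < K -> f' i = j -> same_off (For i k c) f f' ->
       run c f' d (w j) (fun=> True)) ->
  run (For i k c) f (loop_time K d) (flatten [seq w j | j <- iota 0 K]) (fun=> True).
Proof.
move=> fk fresh body; apply: (@run_for _ d w (fun _ _ => True)) => // j f' *.
exact: body.
Qed.

Definition output_time (q : nat) : nat :=
  loop_time n (loop_time q (loop_time q (loop_time n (loop_time q (loop_time q
    (12 * n + 10 * q ^ 2 + 52 * q + 60)))))).

Definition output_cmd : cmd :=
  Mul rp rk rn rq ;;
  Mul rN rk rp rq ;;
  Output (Reg rN) ;;
  For ru rn (For rx1 rq (For rx2 rq (For rv rn (For ry1 rq (For ry2 rq bit_cmd))))).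

Definition blowup_rows (q : nat) : seq nat :=
  flatten [seq flatten [seq flatten [seq
    flatten [seq flatten [seq flatten [seq
      [:: nat_of_bool (blowup_bit q input_adj u x1 x2 v y1 y2)]
    | y2 <- iota 0 q] | y1 <- iota 0 q] | v <- iota 0 n]
    | x2 <- iota 0 q] | x1 <- iota 0 q] | u <- iota 0 n].

Lemma run_output_graph f t :
    let q := f rq in
    f rn = n -> 12 * n + 12 * (n * q) + 18 + output_time q <= t ->
  run output_cmd f t (n * q * q :: blowup_rows q) (fun=> True).
Proof.
move=> q fn le_t.
apply: (@run_seq_silent (12 * n + 8) (fun g => g rp = n * q)).
- by lia.
- apply: run_weaken (run_mul _ _ (leqnn _)) _ _ => //; first by rewrite fn; lia.
  by move=> g _ ->; rewrite fn.
move=> f1 fr1 f1p; have f1q : f1 rq = q by rewrite fr1.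
apply: (@run_seq_silent (12 * (n * q) + 8) (fun g => g rN = n * q * q)).
- by lia.
- apply: run_weaken (run_mul _ _ (leqnn _)) _ _ => //; first by rewrite f1p; lia.
  by move=> g _ ->; rewrite f1p f1q.
move=> f2 fr2 f2N; have f2q : f2 rq = q by rewrite fr2.
have f2n : f2 rn = n by rewrite fr2 // fr1.
rewrite -cat1s; apply: (@run_seq _ 2 (eq^~ f2)); first by lia.
  by rewrite -f2N; apply: run_output.
move=> _ _ ->.
apply: (@run_weaken _ _ _ (output_time q)) (fun _ _ => id); last by lia.
apply: (run_loop f2n) => //.
move=> u g1 lt_u g1u h1; have g1q : g1 rq = q by rewrite h1.
apply: (run_loop g1q) => //.
move=> x1 g2 lt_x1 g2x1 h2; have g2q : g2 rq = q by rewrite h2.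
apply: (run_loop g2q) => //.
move=> x2 g3 lt_x2 g3x2 h3; have g3n : g3 rn = n by rewrite h3 // h2 // h1.
apply: (run_loop g3n) => //.
move=> v g4 lt_v g4v h4; have g4q : g4 rq = q by rewrite h4 // h3.
apply: (run_loop g4q) => //.
move=> y1 g5 lt_y1 g5y1 h5; have g5q : g5 rq = q by rewrite h5.
apply: (run_loop g5q) => //.
move=> y2 g6 lt_y2 g6y2 h6; have g6q : g6 rq = q by rewrite h6.
have g6n : g6 rn = n by rewrite h6 // h5 // h4.
have g6u : g6 ru = u by rewrite h6 // h5 // h4 // h3 // h2.
have g6x1 : g6 rx1 = x1 by rewrite h6 // h5 // h4 // h3.
have g6x2 : g6 rx2 = x2 by rewrite h6 // h5 // h4.
have g6v : g6 rv = v by rewrite h6 // h5.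
have g6y1 : g6 ry1 = y1 by rewrite h6.
have := @run_bit g6; rewrite /= g6q g6n g6u g6x1 g6x2 g6v g6y1 g6y2; apply=> //.
by rewrite lt_x1 lt_x2 lt_y1 lt_y2.
Qed.

(** The guard (D + 1) b - b - a is nonzero exactly when a < D b. Otherwise the code of the
    one-vertex graph is printed. *)
Definition main_cmd : cmd :=
  max_degree_cmd ;;
  Assign rb (Fetch (Const 1)) ;;
  Assign rd1 (Add (Reg rD) (Const 1)) ;;
  Mul rt rk rd1 rb ;;
  If (Defs.Sub (Defs.Sub (Reg rt) (Reg rb)) (Fetch (Const 0)))
    (double_cmd ;; prime_cmd ;; output_cmd)
    (Output (Const 1) ;; Output (Const 0)).

Local Notation degree_time := (n * (n * (12 * n + 25) + 22) + 11).
Local Notation D := max_row_sum.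
Local Notation setup_time := (degree_time + 12 * D + 34).

Lemma run_setup c1 c2 f t w (thr := D.+1 * mu 1) :
    setup_time <= t ->
    (forall g, g rn = n -> g rt = thr ->
       run (if D * mu 1 <= mu 0 then c2 else c1) g (t - setup_time) w (fun=> True)) ->
  run (max_degree_cmd ;;
       Assign rb (Fetch (Const 1)) ;;
       Assign rd1 (Add (Reg rD) (Const 1)) ;;
       Mul rt rk rd1 rb ;;
       If (Defs.Sub (Defs.Sub (Reg rt) (Reg rb)) (Fetch (Const 0))) c1 c2) f t w (fun=> True).
Proof.
move=> le_t cont.
apply: (@run_seq_silent degree_time _ _ _ _ _ _ _ _ (run_max_degree _ (leqnn _))); first by lia.
move=> f1 fr1 [f1n f1D].
do 2!(apply: run_assign_seq; first by rewrite /=; lia).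
set f2 := update _ _ _.
apply: (@run_seq_silent (12 * D + 20) (fun g => g rt = thr)).
- by rewrite /=; lia.
- apply: run_weaken (run_mul _ _ (leqnn _)) _ _ => //.
    by rewrite /f2 /update /= /ev /= /update /= f1D; lia.
  by move=> g _ ->; rewrite /f2 /update /= /ev /= /update /= f1D addn1.
move=> g fr gt; apply: run_if; first by rewrite /=; lia.
rewrite /ev /= gt fr // /f2 /update /= /ev /= /thr mulSn addKn subn_eq0.
by apply: run_weaken (cont g _ gt) _ _ => //; [rewrite fr | rewrite /=; lia].
Qed.

Lemma run_main_trivial f t :
    D * mu 1 <= mu 0 -> setup_time + 4 <= t ->
  run main_cmd f t [:: 1; 0] (fun=> True).
Proof.
move=> le_a le_t; apply: run_setup => [|g gn gt]; first by lia.
rewrite le_a -cat1s; apply: (@run_seq _ 2 (eq^~ g)); first by lia.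
  exact: run_output.
by move=> _ _ ->; apply: run_output => //=; lia.
Qed.

Lemma run_main (k p : nat) f t (thr := D.+1 * mu 1) :
    mu 0 < D * mu 1 ->
    thr <= 2 ^ k * mu 0 -> (forall j, j < k -> 2 ^ j * mu 0 < thr) ->
    3 * 4 ^ k <= p -> prime p -> (forall r, 3 * 4 ^ k <= r < p -> ~~ prime r) ->
    setup_time + (k * 16 + 9) + (p * (p * (10 * p + 25) + 20) + 8)
      + (12 * n + 12 * (n * p) + 18 + output_time p) <= t ->
  run main_cmd f t (n * p * p :: blowup_rows p) (fun=> True).
Proof.
move=> gt_a ge_k lt_k le_p pr_p noprime le_t.
have k4 : 0 < 4 ^ k by rewrite expn_gt0.
apply: run_setup => [|g gn gt]; first by lia.
rewrite leqNgt gt_a /=.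
apply: (@run_seq_silent (k * 16 + 9) (fun g1 => g1 rq = 3 * 4 ^ k)); first by lia.
  by apply: run_double; rewrite ?gt.
move=> g1 fr1 g1q.
apply: (@run_seq_silent (p * (p * (10 * p + 25) + 20) + 8) (fun g2 => g2 rq = p)); first by lia.
  apply: run_prime; rewrite ?g1q //; first by lia.
  by rewrite leq_add2r leq_mul2r; apply/orP; right; lia.
move=> g2 fr2 g2q; rewrite -g2q; apply: run_output_graph; first by rewrite fr2 // fr1.
rewrite g2q; lia.
Qed.
End Program.

(** * Input and output *)

Lemma flatten_iota_mul (T : Type) (g : nat -> seq T) (m k : nat) :
  flatten [seq flatten [seq g (i * k + j) | j <- iota 0 k] | i <- iota 0 m] =
  flatten [seq g i | i <- iota 0 (m * k)].
Proof.
elim: m => // m IHm; rewrite -addn1 iotaD map_cat flatten_cat IHm /= cats0 add0n.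
rewrite mulnDl mul1n iotaD map_cat flatten_cat; congr (_ ++ flatten _).
by rewrite add0n -[m * k in RHS]addn0 iotaDl -map_comp.
Qed.

(** Three nested loops are one loop over the numbers below n q q, read in base q; this matches the
    printed order with the numbering used in [blowup]. *)
Lemma flatten_iota_digits (T : Type) (g : nat -> nat -> nat -> seq T) (n q : nat) :
  flatten [seq flatten [seq flatten [seq
    g u x y | y <- iota 0 q] | x <- iota 0 q] | u <- iota 0 n] =
  flatten [seq g (i %/ q %/ q) (i %/ q %% q) (i %% q) | i <- iota 0 (n * q * q)].
Proof.
have [->|q_gt0] := posnP q.
  by rewrite !muln0 /=; elim: iota.
have divq i j : j \in iota 0 q -> (i * q + j) %/ q = i /\ (i * q + j) %% q = j.
  rewrite mem_iota => /andP[_ lt_j].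
  by rewrite divnMDl // divn_small // addn0 modnMDl modn_small.
rewrite -flatten_iota_mul -(@flatten_iota_mul _ (fun i => flatten [seq
  g ((i * q + j) %/ q %/ q) ((i * q + j) %/ q %% q) ((i * q + j) %% q)
  | j <- iota 0 q])).
congr flatten; apply: eq_map => u; congr flatten; apply/eq_in_map => x xq.
congr flatten; apply/eq_in_map => y yq.
by have [-> ->] := divq (u * q + x) y yq; have [-> ->] := divq u x xq.
Qed.

Lemma adjacency_codeE (N : nat) (e : rel 'I_N) (A : nat -> nat -> bool) :
    (forall i j : 'I_N, A i j = e i j) ->
  graph_code e =
  N :: flatten [seq [seq nat_of_bool (A i j) | j <- iota 0 N] | i <- iota 0 N].
Proof.
move=> EA; rewrite /graph_code -val_enum_ord -map_comp; congr (_ :: flatten _).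
apply: eq_map => i /=; rewrite -map_comp; apply: eq_map => j /=; by rewrite EA.
Qed.

Lemma blowup_code (mu : nat -> nat) (q : nat)
    (e' := fun i j : 'I_(mu 2 * q * q) => blowup q (input_adj mu) i j) :
  graph_code e' = (mu 2 * q * q) :: blowup_rows mu q.
Proof.
rewrite (@adjacency_codeE _ e' (blowup q (input_adj mu))) //; congr (_ :: _).
rewrite /blowup_rows (@flatten_iota_digits _ (fun u x1 x2 =>
  flatten [seq flatten [seq flatten [seq
      [:: nat_of_bool (blowup_bit q (input_adj mu) u x1 x2 v y1 y2)]
    | y2 <- iota 0 q] | y1 <- iota 0 q] | v <- iota 0 (mu 2)])).
congr flatten; apply: eq_map => i; rewrite (@flatten_iota_digits _ (fun v y1 y2 => [:: _])).
by elim: iota => //= j s ->.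
Qed.

Section Input.
Variables (a b n : nat) (e : rel 'I_n).
Let mu := nth 0 [:: a, b & graph_code e].

Lemma input_entry (i j : 'I_n) : mu (3 + (i * n + j)) = e i j.
Proof.
(* The adjacency relation is extended by false to all naturals, so that the matrix can be listed
   over [iota]. *)
pose A (u v : nat) := if insub u is Some i then
  if insub v is Some j then e i j else false else false.
have EA (u v : 'I_n) : A u v = e u v by rewrite /A !valK.
rewrite /mu (adjacency_codeE EA).
have -> : flatten [seq [seq nat_of_bool (A i j) | j <- iota 0 n] | i <- iota 0 n] =
  [seq nat_of_bool (A (k %/ n) (k %% n)) | k <- iota 0 (n * n)].
  transitivity (flatten [seq [:: nat_of_bool (A (k %/ n) (k %% n))] | k <- iota 0 (n * n)]).
    rewrite -flatten_iota_mul; congr flatten; apply: eq_map => u.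
    rewrite -[LHS](@flatten_seq1 _ _); congr flatten; rewrite -map_comp; apply/eq_in_map => v.
    rewrite mem_iota => /andP[_ lt_v] /=.
    have n_gt0 : 0 < n by lia.
    by rewrite divnMDl // divn_small // addn0 modnMDl modn_small.
  by elim: iota => //= k s ->.
have lt_j := ltn_ord j; have n_gt0 : 0 < n by lia.
have lt_k : i * n + j < n * n.
  have := leq_mul (ltn_ord i) (leqnn n); rewrite mulSn; lia.
rewrite /= (nth_map 0) ?size_iota // nth_iota // add0n.
by rewrite divnMDl // divn_small // addn0 modnMDl modn_small // EA.
Qed.

Lemma input_adjE (i j : 'I_n) : input_adj mu i j = e i j.
Proof. by rewrite /input_adj input_entry eqb0 negbK. Qed.

Lemma max_row_sumE : max_row_sum mu = max_degree e.
Proof.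
rewrite /max_row_sum /= big_mkord; apply: eq_bigr => i _.
rewrite big_mkord -sum1dep_card [RHS]big_mkcond /=.
by apply: eq_bigr => j _; rewrite input_entry; case: (e i j).
Qed.

Lemma max_degree_le : max_degree e <= n.
Proof.
by apply/bigmax_leqP => x _; rewrite -[X in _ <= X]card_ord max_card.
Qed.

Lemma computes_of_run c t w :
    run mu c (fun=> 0) t w (fun=> True) ->
  exists2 t', t' <= t & computes_in_time c [:: a, b & graph_code e] t' w.
Proof.
move=> [t' [f' [E le_t _ _]]]; exists t' => //.
by exists (State f' mu w) => //; apply: (E [::]).
Qed.
End Input.

(** * Polynomial time bounds and the final estimates *)

Lemma loop_time_le (K d z c k : nat) :
  0 < z -> K <= z -> d <= c * z ^ k -> loop_time K d <= (c + 14) * z ^ k.+1.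
Proof.
move=> z_gt0 le_K le_d; have zk : 0 < z ^ k by rewrite expn_gt0 z_gt0.
have := leq_mul le_K (leq_add le_d (leqnn 8)); rewrite /loop_time expnS.
have := leq_mul z_gt0 zk; have := leq_mul (leqnn z) zk.
by move: (z ^ k) => Z; lia.
Qed.

(** By [loop_time_le] each of the six output loops raises the degree by 1 and the constant by 14 = 8
    + 6, from 134 z^2 to 218 z^8. The remaining terms have degree at most 3 and fit into 500 z^8. *)
Lemma main_time_le (mu : nat -> nat) (D k p : nat) (n := mu 2) (z := n + p) :
    0 < z -> D <= n -> k <= p ->
  (n * (n * (12 * n + 25) + 22) + 11 + 12 * D + 34) + (k * 16 + 9)
    + (p * (p * (10 * p + 25) + 20) + 8)
    + (12 * n + 12 * (n * p) + 18 + output_time mu p) <= 500 * z ^ 8.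
Proof.
move=> z_gt0 le_D le_k; have le_n : n <= z by apply: leq_addr.
have le_p : p <= z by apply: leq_addl.
have pow i : i <= 8 -> z ^ i <= z ^ 8 by move=> *; rewrite leq_pexp2l.
have nn : n * n <= z ^ 2 by rewrite -mulnn leq_mul.
have np : n * p <= z ^ 2 by rewrite -mulnn leq_mul.
have pp : p * p <= z ^ 2 by rewrite -mulnn leq_mul.
have nnn : n * (n * n) <= z ^ 3 by rewrite expnS leq_mul.
have ppp : p * (p * p) <= z ^ 3 by rewrite expnS leq_mul.
have out_le : output_time mu p <= 218 * z ^ 8.
  rewrite /output_time.
  have T0 : 12 * n + 10 * p ^ 2 + 52 * p + 60 <= 134 * z ^ 2.
    rewrite -[p ^ 2]mulnn.
    have : z <= z ^ 2 by rewrite -{1}(expn1 z) leq_pexp2l.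
    by move: (z ^ 2) pp; lia.
  have T6 := loop_time_le z_gt0 le_n (loop_time_le z_gt0 le_p (loop_time_le z_gt0 le_p
    (loop_time_le z_gt0 le_n (loop_time_le z_gt0 le_p (loop_time_le z_gt0 le_p T0))))).
  by apply: leq_trans T6 _; rewrite leq_mul2r orbT.
have := pow 1 isT; have := pow 2 isT; have := pow 3 isT; rewrite expn1.
have : 0 < z ^ 8 by rewrite expn_gt0 z_gt0.
move: (z ^ 8) (z ^ 3) (z ^ 2) nn np pp nnn ppp out_le => z8 z3 z2.
rewrite !mulnDr; lia.
Qed.

Section Algorithm.
Variables (a b n : nat) (e : rel 'I_n).
Let mu := nth 0 [:: a, b & graph_code e].

Lemma algorithm_large_eps (e1 := fun _ _ : 'I_1 => false) :
    0 < n -> max_degree e * b <= a ->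
  exists2 t, t <= 500 * n ^ 8 &
    computes_in_time main_cmd [:: a, b & graph_code e] t (graph_code e1).
Proof.
move=> n_gt0; rewrite -(max_row_sumE a b) => le_a.
have -> : graph_code e1 = [:: 1; 0] by rewrite (@adjacency_codeE _ _ (fun _ _ => false)).
apply: computes_of_run; apply: run_main_trivial => //.
(* The general bound at k = p = 0 covers this short branch. *)
rewrite max_row_sumE /=; have := @main_time_le mu (max_degree e) 0 0.
rewrite /= addn0 => /(_ n_gt0 (max_degree_le e) (leqnn 0)); change (mu 2) with n; lia.
Qed.

Lemma algorithm_small_eps (D := max_degree e) :
    0 < a -> 0 < n -> a < D * b ->
  exists t k p, let e' := fun i j : 'I_(n * p * p) => blowup p (input_adj mu) i j in
    [/\ t <= 500 * (n + p) ^ 8 /\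
          computes_in_time main_cmd [:: a, b & graph_code e] t (graph_code e'),
        prime p, 3 * 4 ^ k <= p <= 2 ^ 12 * (3 * 4 ^ k) &
        D.+1 * b <= 2 ^ k * a <= 2 * (D.+1 * b)].
Proof.
move=> a_gt0 n_gt0 lt_a; have lt_thr : a < D.+1 * b by rewrite mulSn; lia.
have exk : exists k, D.+1 * b <= 2 ^ k * a.
  exists (D.+1 * b); apply: leq_trans (leq_pmulr _ a_gt0); apply: ltnW; exact: ltn_expl.
case: (ex_minnP exk) => k ge_k min_k.
have lt_k j : j < k -> 2 ^ j * a < D.+1 * b.
  by move=> lt_jk; rewrite ltnNge; apply: contraL lt_jk => /min_k; rewrite -leqNgt.
have k4_gt0 : 0 < 3 * 4 ^ k by rewrite muln_gt0 expn_gt0.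
have exp : exists p, prime p && (3 * 4 ^ k <= p).
  by have [p [pr_p le_p _]] := exists_prime_ge k4_gt0; exists p; rewrite pr_p.
case: (ex_minnP exp) => p /andP[pr_p le_p] min_p.
have le_kp : k <= p.
  apply: leq_trans le_p; have := ltnW (ltn_expl k (isT : 1 < 4)).
  by move: (4 ^ k); lia.
have [t le_t comp] : exists2 t, t <= 500 * (n + p) ^ 8 &
    computes_in_time main_cmd [:: a, b & graph_code e] t (n * p * p :: blowup_rows mu p).
  apply: computes_of_run; apply: (@run_main mu k p); rewrite ?max_row_sumE //.
    move=> r /andP[le_r lt_r]; apply: contraL lt_r => pr_r.
    by rewrite -leqNgt min_p // pr_r.
  by apply: (@main_time_le mu (max_degree e)) => //;
    [rewrite addn_gt0 n_gt0 | apply: max_degree_le].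
exists t, k, p; split=> //.
- by split=> //; rewrite (blowup_code mu p).
- rewrite le_p; have [r [pr_r le_r ge_r]] := exists_prime_ge k4_gt0.
  by apply: leq_trans ge_r; rewrite min_p // pr_r.
(* The upper bound on 2^k a follows from a < (D + 1) b if k = 0, and from minimality of k
   otherwise. *)
rewrite ge_k; case: k {ge_k min_k k4_gt0 exp min_p le_p le_kp} lt_k => [_|k lt_k].
  by rewrite mul1n; lia.
by rewrite expnS -mulnA leq_mul2l ltnW // lt_k.
Qed.
End Algorithm.

Local Open Scope ring_scope.

Theorem theorem6 (R : realType) :
  exists (M : cmd) (T P : {poly {poly R}}) (C : R),
  forall (eps : R) (a b : nat) (n : nat) (e : rel 'I_n),
    0 < eps -> rational_approx a b eps ->
    (0 < n)%N -> simple_graph e ->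
  exists (t N : nat) (e' : rel 'I_N),
    [/\ computes_in_time M [:: a, b & graph_code e] t (graph_code e')
          /\ t%:R <= T.[n%:R%:P].[eps^-1],
        simple_graph e' /\ triangle_free e',
        rel_IS R e <= rel_IS R e' <= (1 + eps) * rel_IS R e,
        N%:R <= P.[(max_degree e)%:R%:P].[eps^-1] * n%:R &
        (max_degree e')%:R <= C * (max_degree e)%:R ^+ 3 * eps ^- 2].
Proof.
(* Naming the constant keeps the unary numeral [2 ^ 12] from being evaluated. *)
have [c c_def] : exists c : nat, c = (2 ^ 12)%N by exists (2 ^ 12)%N.
(* From p <= 3 c m^2 and m <= 8 D / eps one gets p <= 192 c (D / eps)^2. *)
pose K : R := 192 * c%:R.
have K_ge0 : 0 <= K by rewrite mulr_ge0.
(* With s = 1 + n + 1/eps, n + p <= (K + 1) s^4, and the time is at most 500 (n + p)^8. *)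
pose T : {poly {poly R}} := (500 * (K + 1) ^+ 8)%:P%:P * (1 + 'X + 'X%:P) ^+ 32.
(* The second summand bounds p^2; the summand 1 covers the one-vertex output. *)
pose P : {poly {poly R}} := 1 + (K ^+ 2)%:P%:P * 'X ^+ 4 * ('X ^+ 4)%:P.
exists main_cmd, T, P, K => eps a b n e eps_gt0 [b_gt0 /andP[lo_eps hi_eps]] n_gt0 simple_e.
set D := max_degree e; set y := eps^-1.
have y_gt0 : 0 < y by rewrite invr_gt0.
have b_R : 0 < b%:R :> R by rewrite ltr0n.
have n_R : 0 < n%:R :> R by rewrite ltr0n.
have hi : a%:R <= eps * b%:R by rewrite -ler_pdivrMr.
have lo : eps * b%:R <= 2 * a%:R.
  by move: lo_eps; rewrite ler_pdivrMr // mulrAC ler_pdivlMr // [a%:R * _]mulrC.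
have a_gt0 : (0 < a)%N.
  rewrite -(ltr0n R); have : 0 < eps * b%:R by rewrite mulr_gt0.
  lra.
have TE : T.[n%:R%:P].[y] = 500 * (K + 1) ^+ 8 * (1 + n%:R + y) ^+ 32.
  by rewrite /T !hornerE.
have PE : P.[D%:R%:P].[y] = 1 + K ^+ 2 * D%:R ^+ 4 * y ^+ 4.
  by rewrite /P !hornerE.
rewrite TE PE; set s := 1 + n%:R + y.
have s_ge1 : 1 <= s by rewrite /s -addrA lerDl addr_ge0 // ltW.
have s_ge0 : 0 <= s by apply: le_trans s_ge1.
have time_le (t z : nat) : (t <= 500 * z ^ 8)%N -> z%:R <= (K + 1) * s ^+ 4 ->
    t%:R <= 500 * (K + 1) ^+ 8 * s ^+ 32.
  move=> le_t le_z; apply: (@le_trans _ _ (500 * z%:R ^+ 8)).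
    by move: le_t; rewrite -(ler_nat R) natrM natrX.
  have -> : s ^+ 32 = (s ^+ 4) ^+ 8 by rewrite -exprM.
  rewrite -mulrA ler_wpM2l // -exprMn.
  apply: lerXn2r => //; rewrite nnegrE; first exact: ler0n.
  by apply: mulr_ge0; [apply: addr_ge0 | apply: exprn_ge0].
have n_le_s : n%:R <= s by rewrite /s; lra.
have y_le_s : y <= s by rewrite /s; lra.
have IS_R : n%:R <= (IS e)%:R * (D%:R + 1) :> R.
  have := card_le_IS_degree simple_e; rewrite card_ord -(ler_nat R) natrM.
  by rewrite -addn1 natrD.
have D_ge0 : 0 <= D%:R :> R by [].
(* If a >= D b, then eps >= D, so (1 + eps) rel_IS(G) >= (1 + D) / (D + 1) = 1, the relative
   independence number of a single vertex. *)
have [le_a|lt_a] := leqP (D * b) a.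
  have [t le_t comp] := algorithm_large_eps n_gt0 le_a.
  have IS1 : IS (fun _ _ : 'I_1 => false) = 1%N.
    apply/eqP; rewrite eqn_leq (leq_trans (IS_le_card _)) ?card_ord //=.
    have : independent (fun _ _ : 'I_1 => false) [set: 'I_1] by apply/independentP.
    by move/leq_IS; rewrite cardsT card_ord.
  exists t, 1%N, (fun _ _ => false); split.
  - split=> //; apply: time_le le_t _.
    apply: le_trans n_le_s _; rewrite -[leLHS]mul1r ler_pM //; try lra.
    by rewrite -[leLHS]expr1 ler_weXn2l.
  - by split=> // -[|x [|z [|w [|v s']]]].
  - rewrite /rel_IS IS1 !card_ord divr1; apply/andP; split.
      by rewrite ler_pdivrMr // mul1r ler_nat (leq_trans (IS_le_card e)) ?card_ord.
    rewrite mulrA ler_pdivlMr // mul1r.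
    have le_D : D%:R <= eps.
      rewrite -(ler_pM2r b_R) (le_trans _ hi) // -natrM ler_nat //.
    apply: le_trans IS_R _; rewrite mulrC ler_wpM2r //; lra.
  - have : 1 <= n%:R :> R by rewrite ler1n.
    have : 0 <= K ^+ 2 * D%:R ^+ 4 * y ^+ 4 by rewrite !mulr_ge0 ?exprn_ge0 // ltW.
    nra.
  - rewrite (_ : max_degree _ = 0%N) ?mulr_ge0 ?exprn_ge0 ?invr_ge0 ?exprn_ge0 // 1?ltW //.
    apply/eqP; rewrite -leqn0; apply/bigmax_leqP => x _; rewrite leqn0 cards_eq0.
    by apply/eqP/setP => z; rewrite !inE.
have [t [k [p [[le_t comp] pr_p /andP[le_p p_le] /andP[ge_k k_le]]]]] :=
  algorithm_small_eps a_gt0 n_gt0 lt_a.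
set e' := fun i j => _ in comp.
have k2_gt0 : (0 < 2 ^ k)%N by rewrite expn_gt0.
have k4 : (4 ^ k = 2 ^ k * 2 ^ k)%N by rewrite -expnMn.
have p_gt2 : (2 < p)%N.
  by apply: leq_trans le_p; rewrite -[X in (X <= _)%N]muln1 leq_mul2l expn_gt0.
have m_le : (3 * (2 ^ k) ^ 2 <= p)%N by rewrite -mulnn -k4.
have [tf_e' IS_lo IS_hi deg_le] := blowup_correct pr_p p_gt2 simple_e (input_adjE a b e) m_le.
rewrite -/e' in tf_e' IS_lo IS_hi deg_le.
set m := (2 ^ k)%N in k2_gt0 k4 IS_hi ge_k k_le m_le.
have D_gt0 : (0 < D)%N by case: posnP lt_a => // ->.
have D_R : 1 <= D%:R :> R by rewrite ler1n.
have a_R : 0 < a%:R :> R by rewrite ltr0n.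
have m_R : 0 < m%:R :> R by rewrite ltr0n.
have ey : eps * y = 1 by rewrite mulfV // gt_eqF.
(* Here m a <= 2 (D + 1) b <= 4 D b as D >= 1, and b <= 2 a / eps because a / b is at least eps /
   2. *)
have m_bound : m%:R <= 8 * (D%:R * y).
  move: k_le; rewrite -(ler_nat R) !natrM -addn1 natrD => k_le.
  rewrite -(ler_pM2r a_R) (le_trans k_le) //.
  have b_le : b%:R <= 2 * a%:R * y.
    by rewrite -(ler_pM2l eps_gt0) (le_trans lo) // mulrCA ey mulr1.
  rewrite (_ : 8 * _ * _ = 4 * D%:R * (2 * a%:R * y)); last by ring.
  apply: le_trans (_ : 4 * D%:R * b%:R <= _); last by rewrite ler_wpM2l // mulr_ge0.
  have : 0 <= (D%:R - 1) * b%:R :> R by rewrite mulr_ge0 ?subr_ge0 // ltW.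
  rewrite -[max_degree e]/D; nra.
have p_bound : p%:R <= K * (D%:R * y) ^+ 2.
  move: p_le; rewrite k4 -c_def -(ler_nat R) !natrM => p_le.
  rewrite (le_trans p_le) // /K.
  have mm : m%:R * m%:R <= (8 * (D%:R * y)) ^+ 2 by rewrite expr2 ler_pM // ltW.
  rewrite (_ : 192 * c%:R * (D%:R * y) ^+ 2 = c%:R * (3 * (8 * (D%:R * y)) ^+ 2)); last by ring.
  by rewrite !ler_wpM2l.
have p_R : 0 < p%:R :> R by rewrite ltr0n prime_gt0.
exists t, (n * p * p)%N, e'; split=> //.
- split=> //; apply: time_le le_t _; rewrite natrD mulrDl mul1r addrC lerD //.
    apply: le_trans p_bound _; rewrite ler_wpM2l // exprMn -[4%N]/(2 + 2)%N exprD.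
    have DR : D%:R <= n%:R :> R by rewrite ler_nat max_degree_le.
    have sq (x : R) : 0 <= x -> x <= s -> x ^+ 2 <= s ^+ 2.
      by move=> x_ge0; apply: lerXn2r; rewrite nnegrE.
    apply: ler_pM; rewrite ?exprn_ge0 ?(ltW y_gt0) //; last by apply: sq => //; apply: ltW.
    by apply: sq => //; apply: le_trans n_le_s.
  by apply: le_trans n_le_s _; rewrite -[leLHS]expr1 ler_weXn2l.
- rewrite /rel_IS !card_ord !natrM.
  move: IS_lo IS_hi; rewrite -!mulnn -!(ler_nat R) natrD !natrM -expr2.
  move: (IS e')%:R => i'; move: (IS e)%:R IS_R => i IS_R IS_lo IS_hi.
  have npp : 0 < n%:R * p%:R * p%:R :> R by rewrite !mulr_gt0.
  have iE (x : R) : x / n%:R * (n%:R * p%:R * p%:R) = x * p%:R ^+ 2.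
    by field; rewrite gt_eqF.
  apply/andP; split; first by rewrite ler_pdivlMr // iE.
  rewrite ler_pdivrMr // [(1 + eps) * _]mulrA iE -(ler_pM2r m_R) (le_trans IS_hi) //.
  rewrite (_ : (1 + eps) * i * p%:R ^+ 2 * m%:R =
    i * p%:R ^+ 2 * m%:R + (eps * i * m%:R) * p%:R ^+ 2);
    last by ring.
  (* What remains is n <= eps i m, which follows from n b <= i (D + 1) b <= i m a <= i m eps b. *)
  rewrite lerD2l ler_wpM2r ?exprn_ge0 // -(ler_pM2r b_R).
  have i_ge0 : 0 <= i.
    have D1 : 0 < D%:R + 1 :> R by lra.
    by rewrite -(pmulr_lge0 _ D1) (le_trans _ IS_R).
  apply: (@le_trans _ _ (i * (m%:R * a%:R))); last first.
    rewrite (_ : eps * i * m%:R * b%:R = i * (m%:R * (eps * b%:R))); last by ring.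
    by rewrite !ler_wpM2l // ltW.
  apply: (@le_trans _ _ (i * (D%:R + 1) * b%:R)); first by rewrite ler_wpM2r // ltW.
  by rewrite -mulrA ler_wpM2l //; move: ge_k; rewrite -(ler_nat R) !natrM -addn1 natrD.
- rewrite !natrM.
  have pp : p%:R * p%:R <= (K * (D%:R * y) ^+ 2) ^+ 2 by rewrite expr2 ler_pM // ltW.
  rewrite -mulrA mulrC ler_wpM2r // (le_trans pp) //.
  rewrite (_ : (K * _) ^+ 2 = K ^+ 2 * D%:R ^+ 4 * y ^+ 4) ?lerDr //; ring.
rewrite (le_trans (_ : _ <= (D * p)%:R)) ?ler_nat // natrM.
rewrite (le_trans (ler_wpM2l D_ge0 p_bound)) // -exprVn -/y.
rewrite (_ : D%:R * _ = K * D%:R ^+ 3 * y ^+ 2) //; ring.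
Qed.
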